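(* For linear chains $\mathcal{L}$ and $\mathcal{L}'$, the following are equivalent: 1. $\mathcal{L}\sim\mathcal{L}'$; 2. $\|\mathcal{L}\|=\|\mathcal{L}'\|$, $\det\mathcal{L}=\det\mathcal{L}'$ and $\overline{\mathrm{Sub}}(\mathcal{L})\cap\overline{\mathrm{Sub}}(\mathcal{L}')\neq\varnothing$.
   Context: Graphs are finite, undirected, without loops or multiple edges; a weighted graph has an integer weight at each vertex. A linear chain is a weighted tree (possibly empty) in which every vertex has degree at most two; $[x_1,\dots,x_q]$ denotes the linear chain whose vertices have successive weights $x_1,\dots,x_q$ (so $[x_1,\dots,x_q]=[x_q,\dots,x_1]$). Blowing-up of a weighted graph $\mathcal G$: (i) at a vertex $v$: add a new vertex $e$ of weight $-1$ joined to $v$, and decrease the weight of $v$ by $1$; (ii) at an edge $\{v_1,v_2\}$: delete the edge, add a new vertex $e$ of weight $-1$ joined to $v_1$ and to $v_2$, and decrease the weights of $v_1,v_2$ by $1$; (iii) free: add an isolated vertex $e$ of weight $-1$. (Any weighted graph isomorphic to such a graph is also called a blowing-up.) Blowing-down is the inverse operation. $\mathcal{G}\sim\mathcal{G}'$ means that one can be obtained from the other by a finite sequence of blowings-up and blowings-down. Given a weighted graph $\mathcal G$ with vertices $v_1,\dots,v_n$, let $M$ be the symmetric matrix with $M_{ii}=$ weight of $v_i$, and for $i\ne j$, $M_{ij}=1$ if $v_i,v_j$ are adjacent, $0$ otherwise; let $B_{\mathcal G}$ be the bilinear form on $\mathbb{R}^n$ with matrix $M$. Then $\det(\mathcal G)=\det(-M)$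 (equal to $1$ for the empty graph), and $\|\mathcal G\|$ is the maximum dimension of a subspace $W\subseteq\mathbb{R}^n$ with $B_{\mathcal G}(x,x)\ge0$ for all $x\in W$. For a finite sequence $X=(x_1,\dots,x_n)$ of integers, let $\det(X)=\det([X])$, and let $\det_1(X)=\det(x_2,\dots,x_n)$ if $n\ge2$, $\det_1(X)=1$ if $n=1$, $\det_1(X)=0$ if $n=0$. Let $X^-=(x_n,\dots,x_1)$ and $\mathrm{Sub}(X)=(\det_1(X),\det_1(X^-))\in\mathbb{Z}\times\mathbb{Z}$. For a linear chain $\mathcal L=[L]$ with $\mathrm{Sub}(L)=(x,y)$, set $\mathrm{Sub}(\mathcal L)=\{x,y\}\subset\mathbb{Z}$, and let $\overline{\mathrm{Sub}}(\mathcal L)\subset\mathbb{Z}/d\mathbb{Z}$, with $d=\det(\mathcal L)$, be the image of $\mathrm{Sub}(\mathcal L)$ under $\mathbb{Z}\to\mathbb{Z}/d\mathbb{Z}$. *)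

(* Defs.v *)
From HB Require Import structures.
From mathcomp Require Import all_boot all_order all_algebra.
From mathcomp Require Import boolp classical_sets reals.
From Stdlib Require Import Relation_Operators.

Set Implicit Arguments.
Unset Strict Implicit.
Unset Printing Implicit Defensive.

Import Order.TTheory GRing.Theory Num.Theory.
Local Open Scope ring_scope.

Record wgraph := WGraph {
  vertex :> finType;
  adj : rel vertex;
  weight : vertex -> int;
  adj_sym : symmetric adj;
  adj_irr : irreflexive adj
}.

Definition wg_iso (G H : wgraph) : Prop :=
  exists f : G -> H, [/\ bijective f,
    forall x y, adj (f x) (f y) = adj x y &
    forall x, weight (f x) = weight x].

Section Blowup.
Variables (G : wgraph) (S : {set G}).

(* The new vertex is [None]; it is joined to the elements of [S], whose weights
   drop by 1, and an edge with both ends in [S] is deleted.  Only the cases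
   S = {v}, S = {v1, v2} with v1, v2 adjacent, and S = set0 are used. *)
Definition blow_adj (a b : option G) : bool :=
  match a, b with
  | Some x, Some y => adj x y && ~~ ((x \in S) && (y \in S))
  | Some x, None | None, Some x => x \in S
  | None, None => false
  end.

Definition blow_weight (a : option G) : int :=
  if a is Some x then (if x \in S then weight x - 1 else weight x) else -1.

Lemma blow_adj_sym : symmetric blow_adj.
Proof. by move=> [x|] [y|] //=; rewrite adj_sym [(y \in S) && _]andbC. Qed.

Lemma blow_adj_irr : irreflexive blow_adj.
Proof. by move=> [x|] //=; rewrite adj_irr. Qed.

Definition blow : wgraph := WGraph blow_weight blow_adj_sym blow_adj_irr.

End Blowup.

Inductive blowing_up (G H : wgraph) : Prop :=
| BlowVertex (v : G) of wg_iso (blow [set v]%SET) H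
| BlowEdge (v1 v2 : G) of adj v1 v2 & wg_iso (blow [set v1; v2]%SET) H
| BlowFree of wg_iso (blow (@finset.set0 G)) H.

Definition wg_equiv : wgraph -> wgraph -> Prop :=
  clos_refl_sym_trans wgraph blowing_up.

Definition connected_graph (G : wgraph) : Prop :=
  forall x y : G, connect (@adj G) x y.

Definition acyclic (G : wgraph) : Prop :=
  forall c : seq G, (2 < size c)%N -> ~ ucycle (@adj G) c.

Definition tree (G : wgraph) : Prop := connected_graph G /\ acyclic G.

Definition degree (G : wgraph) (x : G) : nat := #|[set y | adj x y]%SET|.

Definition linear_chain (G : wgraph) : Prop :=
  tree G /\ forall x : G, (degree x <= 2)%N.

Definition wg_mx (G : wgraph) : 'M[int]_#|G| :=
  \matrix_(i, j) if i == j then weight (enum_val i)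
                 else (adj (enum_val i) (enum_val j))%:R.

Definition wdet (G : wgraph) : int := \det (- wg_mx G).

Definition wform (R : realType) (G : wgraph) (x y : 'rV[R]_#|G|) : R :=
  (x *m map_mx intr (wg_mx G) *m y^T) 0 0.

Definition nonneg_subspace (R : realType) (G : wgraph)
  (W : {vspace 'rV[R]_#|G|}) : Prop :=
  forall x, x \in W -> 0 <= wform x x.

(* ||G||; the zero subspace shows that the maximum is over a nonempty set. *)
Definition wnorm (R : realType) (G : wgraph) : nat :=
  \max_(k < #|G|.+1 |
        `[< exists W : {vspace 'rV[R]_#|G|}, nonneg_subspace W /\ \dim W = k >])
    k.

Section Chain.
Variable X : seq int.

Definition chain_adj (i j : 'I_(size X)) : bool :=
  (i.+1 == j :> nat) || (j.+1 == i :> nat).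

Lemma chain_adj_sym : symmetric chain_adj.
Proof. by move=> i j; rewrite /chain_adj orbC. Qed.

Lemma chain_adj_irr : irreflexive chain_adj.
Proof. by move=> i; rewrite /chain_adj orbb gtn_eqF. Qed.

Definition chain : wgraph :=
  @WGraph 'I_(size X) chain_adj (fun i => X`_i) chain_adj_sym chain_adj_irr.

End Chain.

Definition det0 (X : seq int) : int := wdet (chain X).

(* If X has one term, the value is det0 [::] = 1. *)
Definition det1 (X : seq int) : int := if X is _ :: X' then det0 X' else 0.

(* The sequence X with G isomorphic to [X] is unique up to reversal. *)
Definition Sub (G : wgraph) : set int :=
  [set z | exists X : seq int,
     wg_iso (chain X) G /\ (z = det1 X \/ z = det1 (rev X))]%classic.

(* A class in Z/dZ is represented by its remainder modulo d = wdet G.  As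
   [modz m 0 = m] and [modz m (- d) = modz m d], this is also right when d is
   zero (where Z/dZ = Z) or negative. *)
Definition Subbar (G : wgraph) : set int :=
  [set (z %% wdet G)%Z | z in Sub G]%classic.

(* Main.v *)
Require Import Defs.
From HB Require Import structures.
From mathcomp Require Import all_boot all_order all_algebra all_fingroup.
From mathcomp Require Import boolp classical_sets reals.
From mathcomp Require Import zify ring lra.
From Stdlib Require Import Relation_Operators.

(** Let M be the matrix of a weighted graph.  All the blowings-up are instances
    of a single operation, the blowing-up at a clique S with at most two
    elements, which turns the quadratic form Q into
    Q(x) - (t - \sum_(v in S) x_v)^2 for a new coordinate t.  So, up to a
    unimodular change of coordinates, a form of rank one with matrix -1 splits
    off, and both the determinant and the norm are invariant.

    For the third condition consider the cokernel H of M, with the class e_v of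
    each vertex, and the element \sum_v (deg v - 2) [e_v] of the free abelian
    group on the set H. A blowing-up does not change H, its new vertex has the
    class \sum_(v in S) e_v, and by a count of degrees the formal sum changes by
    a multiple of [0] only. For a chain X with vertices v_1, ..., v_n, n >= 1,
    and determinant d, H is cyclic of order d (infinite if d = 0), generated by
    e_(v_n); moreover e_(v_1) = det1 X * e_(v_n), and the formal sum is -
    [e_(v_1)] - [e_(v_n)]. Hence, for equivalent chains X and X' with d
    different from 1 and -1, an isomorphism of the groups H either matches the
    last vertices or matches the last vertex of X with the first one of X', and
    this gives det1 X = det1 X' or det1 X = det1 (rev X') modulo d. Below the
    group H appears through the homomorphisms from H to Z/dZ, which are the
    [labeling]s; [label_transfer_equiv] is the invariance and
    [chain_equiv_continuant1] the conclusion for chains.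

    Conversely, [normal_form] brings each sequence by blowings-up and
    blowings-down of chains to k pairs 0, 0 followed by a sequence Z that is
    either [0] or has all its entries at most -2.  A nonnegative entry can be
    lowered to 0; a weight can be moved across an entry 0, so that a pair 0, 0
    appears and travels to the front; entries -1 are contracted.  These moves
    preserve d, and preserve det1 modulo d since the two ends are never
    exchanged.  The norm is k + 1 in the first case and k in the second one, and
    d is zero only in the first case, so the norm and d determine k and the
    case.  In the second case 0 <= det1 Z < det Z, so that d and det1 modulo d
    determine the pair (det Z, det1 Z) = +-(d, det1), and Z is the expansion of
    det Z / det1 Z as a Hirzebruch-Jung continued fraction. *)

Set Implicit Arguments.
Unset Strict Implicit.
Unset Printing Implicit Defensive.
Import Order.TTheory GRing.Theory Num.Theory.
Local Open Scope ring_scope.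

(** * Isomorphisms and blowings-up at cliques *)

Lemma wg_iso_refl G : wg_iso G G.
Proof. by exists id; split=> //; exists id. Qed.

Lemma wg_iso_sym G H : wg_iso G H -> wg_iso H G.
Proof.
case=> f [[g fK gK] adjf wf]; exists g; split; first by exists f.
  by move=> x y; rewrite -adjf !gK.
by move=> x; rewrite -wf gK.
Qed.

Lemma wg_iso_trans G H K : wg_iso G H -> wg_iso H K -> wg_iso G K.
Proof.
case=> f [bf adjf wf] [g [bg adjg wg]]; exists (g \o f); split.
- exact: bij_comp.
- by move=> x y /=; rewrite adjg adjf.
- by move=> x /=; rewrite wg wf.
Qed.

Lemma wg_iso_blow0 G H :
  wg_iso G H -> wg_iso (blow (@finset.set0 G)) (blow (@finset.set0 H)).
Proof.
case=> f [[g fK gK] adjf wf].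
exists (omap f : blow finset.set0 -> blow finset.set0); split.
- by exists (omap g); case=> [x|] //=; rewrite ?fK ?gK.
- by case=> [x|] [y|] //=; rewrite ?adjf ?finset.inE.
- by case=> [x|] //=; rewrite ?wf ?finset.inE.
Qed.

(** Isomorphic graphs have the same blowings-up, for example the free one. *)
Lemma wg_iso_equiv G H : wg_iso G H -> wg_equiv G H.
Proof.
move=> iGH; apply: (@rst_trans _ _ _ (blow (@finset.set0 G))).
  by apply: rst_step; apply: BlowFree; apply: wg_iso_refl.
apply: rst_sym; apply: rst_step; apply: BlowFree.
exact/wg_iso_blow0/wg_iso_sym.
Qed.

Definition wmat (G : wgraph) (u v : G) : int :=
  if u == v then weight u else (adj u v)%:R.

Lemma wg_mxE (G : wgraph) i j : wg_mx G i j = wmat (enum_val i) (enum_val j).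
Proof. by rewrite mxE /wmat (inj_eq enum_val_inj). Qed.

Definition wclique (G : wgraph) (S : {set G}) :=
  forall u v, u \in S -> v \in S -> u != v -> adj u v.

Section BlowMat.
Variables (G : wgraph) (S : {set G}).
Hypothesis cS : wclique S.

(** On the old vertices, the weights that drop and the edge that disappears
    are together the subtraction of the rank one matrix s^T s, where s is the
    indicator of [S]. *)
Lemma wmat_blowS (u v : G) :
  wmat (Some u : blow S) (Some v) = wmat u v - ((u \in S) && (v \in S))%:R.
Proof.
rewrite /wmat (_ : (Some u == Some v :> blow S) = (u == v)) //=.
case: eqVneq => [<-|nuv]; first by rewrite andbb; case: (u \in S); rewrite ?subr0.
case: (boolP (u \in S)) => uS; case: (boolP (v \in S)) => vS;
  by rewrite /= ?andbT ?andbF ?subr0 // (cS uS vS nuv).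
Qed.

Lemma wmat_blowN (v : G) : wmat (None : blow S) (Some v) = (v \in S)%:R.
Proof. by []. Qed.

Lemma wmat_blowN' (v : G) : wmat (Some v : blow S) None = (v \in S)%:R.
Proof. by []. Qed.

Lemma wmat_blowNN : wmat (None : blow S) None = -1.
Proof. by []. Qed.

End BlowMat.

(** The three kinds of blowings-up are treated at once by means of cliques. *)
Lemma wg_equiv_invariant (P : wgraph -> wgraph -> Prop) :
  (forall G, P G G) ->
  (forall G H, P G H -> P H G) ->
  (forall G H K, P G H -> P H K -> P G K) ->
  (forall G H, wg_iso G H -> P G H) ->
  (forall (G : wgraph) (S : {set G}), wclique S -> (#|S| <= 2)%N -> P G (blow S)) ->
  forall G H, wg_equiv G H -> P G H.
Proof.
move=> Prefl Psym Ptrans Piso Pblow G H; elim=> {G H}; last 3 first.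
- exact: Prefl.
- by move=> G H _; apply: Psym.
- by move=> G H K _ PGH _; apply: Ptrans.
move=> G H []=> [v|v1 v2 a12|] iso; apply: Ptrans (Piso _ _ iso);
  apply: Pblow.
- by move=> x y /finset.set1P -> /finset.set1P ->; rewrite eqxx.
- by rewrite cards1.
- by move=> x y /finset.set2P[] -> /finset.set2P[] ->; rewrite ?eqxx // adj_sym.
- by rewrite cards2; case: eqP.
- by move=> x y; rewrite finset.inE.
- by rewrite cards0.
Qed.

(** * Invariance of the determinant *)

Lemma det_reindex (T : finType) (A : comNzRingType) n (e : 'I_n -> T)
    (F : T -> T -> A) : bijective e ->
  \det (\matrix_(i, j) F (e i) (e j)) =
  \det (\matrix_(i < #|T|, j < #|T|) F (enum_val i) (enum_val j)).
Proof.
move=> be; have := bij_eq_card be; rewrite card_ord => En; subst n.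
have inj_s : injective (enum_rank \o e).
  by apply: inj_comp (bij_inj be); apply: enum_rank_inj.
pose s := perm inj_s.
set M := (RHS in _ = \det RHS).
rewrite (_ : \matrix_(i, j) _ = row_perm s (col_perm s M)); last first.
  by apply/matrixP=> i j; rewrite !mxE !permE /= !enum_rankK.
rewrite row_permE col_permE !det_mulmx !det_perm mulrC -mulrA.
by rewrite odd_permV -expr2 sqrr_sign mulr1.
Qed.

Lemma wdetE (G : wgraph) n (e : 'I_n -> G) : bijective e ->
  wdet G = \det (\matrix_(i, j) - wmat (e i) (e j)).
Proof.
move=> be; rewrite (det_reindex (fun u v => - wmat u v) be).
by congr (\det _); apply/matrixP=> i j; rewrite [LHS]mxE wg_mxE mxE.
Qed.

Lemma wmat_iso (G H : wgraph) (f : G -> H) : bijective f ->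
  (forall x y, adj (f x) (f y) = adj x y) -> (forall x, weight (f x) = weight x) ->
  forall x y, wmat (f x) (f y) = wmat x y.
Proof. by move=> bf af wf x y; rewrite /wmat (bij_eq bf) af wf. Qed.

Lemma wdet_iso G H : wg_iso G H -> wdet G = wdet H.
Proof.
case=> f [bf af wf].
rewrite (wdetE (@enum_val_bij G)).
rewrite (wdetE (bij_comp bf (@enum_val_bij G))).
by congr (\det _); apply/matrixP=> i j; rewrite !mxE /= (wmat_iso bf af wf).
Qed.

(** With the new vertex first, the matrix of the blowing-up is
    [[1, -s], [-s^T, -M + s^T s]], where s is the indicator of [S]; a row
    operation clears the lower left block and restores -M. *)
Lemma wdet_blow (G : wgraph) (S : {set G}) : wclique S -> wdet (blow S) = wdet G.
Proof.
move=> cS.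
pose e (i : 'I_(1 + #|G|)) : blow S :=
  if split i is inr j then Some (enum_val j) else None.
pose e' (x : blow S) : 'I_(1 + #|G|) :=
  if x is Some v then rshift 1 (enum_rank v) else lshift _ ord0.
have be : bijective e.
  exists e'.
    move=> i; rewrite /e /e' -[i in RHS]splitK.
    by case: (split i) => j /=; rewrite ?enum_valK ?ord1.
  case=> [v|]; rewrite /e /e'.
    by rewrite (unsplitK (inr (enum_rank v))) enum_rankK.
  by rewrite (unsplitK (inl ord0)).
pose s : 'rV[int]_#|G| := \row_j (enum_val j \in S)%:R.
pose A : 'M[int]_#|G| := \matrix_(i, j) - wmat (enum_val i) (enum_val j).
rewrite (wdetE be) (wdetE (@enum_val_bij G)) -/A.
rewrite (_ : \matrix_(i, j) _ = block_mx 1%:M (- s) (- s^T) (A + s^T *m s)).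
  have <- : \det (block_mx 1%:M 0 s^T 1%:M : 'M[int]_(1 + #|G|)) = 1.
    by rewrite det_lblock !det1 mulr1.
  transitivity (\det ((block_mx 1%:M 0 s^T 1%:M : 'M[int]_(1 + #|G|)) *m
      block_mx 1%:M (- s) (- s^T) (A + s^T *m s))).
    by rewrite det_mulmx det_lblock !det1 !mul1r.
  rewrite mulmx_block !mul1mx !mul0mx !addr0 mulmx1 subrr mulmxN addrC.
  by rewrite addrK det_ublock !det1 mul1r.
apply/matrixP=> i j; rewrite -[i]splitK -[j]splitK.
case: (split i) => {}i; case: (split j) => {}j; rewrite mxE /e !unsplitK /=.
- by rewrite block_mxEul !ord1 mxE eqxx wmat_blowNN opprK.
- by rewrite block_mxEur !mxE wmat_blowN.
- by rewrite block_mxEdl !mxE wmat_blowN'.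
- rewrite block_mxEdr !mxE big_ord_recl big_ord0 !mxE wmat_blowS // opprB addr0.
  by rewrite addrC -natrM mulnb.
Qed.

Lemma wdet_equiv G H : wg_equiv G H -> wdet G = wdet H.
Proof.
apply: (wg_equiv_invariant (P := fun G H => wdet G = wdet H)) => {G H} //.
- by move=> G H K -> ->.
- exact: wdet_iso.
- by move=> G S cS _; rewrite wdet_blow.
Qed.

Lemma big_option (A : zmodType) (G : finType) (h : option G -> A) :
  \sum_u h u = h None + \sum_u h (Some u).
Proof.
rewrite (bigD1 None) //= (reindex_omap Some id) /=; last by case.
by congr (_ + _); apply: eq_bigl => u; rewrite eqxx.
Qed.

Lemma sum_mem_set (A : pzRingType) (G : finType) (S : {set G}) (x : G -> A) :
  \sum_(u in S) x u = \sum_u (u \in S)%:R * x u.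
Proof.
by rewrite big_mkcond /=; apply: eq_bigr => u _; case: ifP; rewrite ?mul1r ?mul0r.
Qed.

Lemma card_sum_mem (G : finType) (S : {set G}) : #|S|%:Z = \sum_v (v \in S)%:R.
Proof.
rewrite -natz -sum1_card natr_sum big_mkcond /=.
by apply: eq_bigr => v _; case: ifP.
Qed.

(** * Invariance of the norm *)

Section Norm.
Variable R : realType.

Definition qform (G : wgraph) (x : G -> R) : R :=
  \sum_u \sum_v x u * (wmat u v)%:~R * x v.

Definition fun_of_row (G : wgraph) (x : 'rV[R]_#|G|) (u : G) : R :=
  x 0 (enum_rank u).

Lemma wform_qform (G : wgraph) (x : 'rV[R]_#|G|) :
  wform x x = qform (fun_of_row x).
Proof.
rewrite /wform /qform mxE exchange_big /=.
rewrite [RHS](reindex _ (onW_bij _ (@enum_val_bij G))) /=.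
apply: eq_bigr => j _; rewrite mxE mulr_suml.
rewrite [RHS](reindex _ (onW_bij _ (@enum_val_bij G))) /=.
by apply: eq_bigr => i _; rewrite /fun_of_row !enum_valK !mxE -wg_mxE [in RHS]mxE.
Qed.

Lemma wnorm_max (G : wgraph) (W : {vspace 'rV[R]_#|G|}) :
  nonneg_subspace W -> (\dim W <= wnorm R G)%N.
Proof.
move=> W0; have dW : (\dim W < #|G|.+1)%N.
  by rewrite ltnS (leq_trans (dimvS (subvf W))) // dimvf /dim /= mul1n.
apply: (@leq_bigmax_cond _ _ (fun k : 'I_#|G|.+1 => k : nat) (Ordinal dW)).
by apply/asboolP; exists W.
Qed.

Lemma wnorm_attained (G : wgraph) :
  exists W : {vspace 'rV[R]_#|G|}, nonneg_subspace W /\ \dim W = wnorm R G.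
Proof.
pose P (k : 'I_#|G|.+1) :=
  `[< exists W : {vspace 'rV[R]_#|G|}, nonneg_subspace W /\ \dim W = k >].
have P0 : P ord0.
  apply/asboolP; exists 0%VS; split; last by rewrite dimv0.
  by move=> x; rewrite memv0 => /eqP->; rewrite /wform !mul0mx mxE.
have : (0 < #|P|)%N by apply/card_gt0P; exists ord0.
move=> /(eq_bigmax_cond (fun k : 'I_#|G|.+1 => k : nat)) [k /asboolP[W [W0 dW]] Ek].
by exists W; split=> //; rewrite dW -Ek.
Qed.

Definition fun_linear (T : Type) (V : lmodType R) (f : (T -> R) -> V) :=
  forall a x y, f (fun t => a * x t + y t) = a *: f x + f y.

Lemma hom_of_linear (U V : vectType R) (f : U -> V) :
  linear f -> exists g : 'Hom(U, V), forall x, g x = f x.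
Proof.
move=> lf; pose f' : {linear U -> V} :=
  HB.pack_for {linear U -> V} f (GRing.isLinear.Build R U V _ f lf).
by exists (linfun f') => x; rewrite lfunE.
Qed.

Lemma fun_of_row_linear (G : wgraph) a (x y : 'rV[R]_#|G|) :
  fun_of_row (a *: x + y) = (fun u => a * fun_of_row x u + fun_of_row y u).
Proof. by apply/funext => u; rewrite /fun_of_row !mxE. Qed.

Lemma fun_of_row_eq0 (G : wgraph) (x : 'rV[R]_#|G|) :
  (forall u, fun_of_row x u = 0) -> x = 0.
Proof.
move=> x0; apply/rowP => i; rewrite mxE -(enum_valK i).
exact: (x0 (enum_val i)).
Qed.

Lemma fun_of_row_surj (G : wgraph) (x : G -> R) :
  fun_of_row (\row_i x (enum_val i)) = x.
Proof. by apply/funext => u; rewrite /fun_of_row mxE enum_rankK. Qed.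

Lemma hom_of_fun_linear (G H : wgraph) (F : (G -> R) -> (H -> R)) :
  (forall h, fun_linear (fun x => F x h : R^o)) ->
  exists g : 'Hom('rV[R]_#|G|, 'rV[R]_#|H|),
    forall x, fun_of_row (g x) = F (fun_of_row x).
Proof.
move=> linF; have [g gE] : exists g : 'Hom('rV[R]_#|G|, 'rV[R]_#|H|),
    forall x, g x = \row_i F (fun_of_row x) (enum_val i).
  apply: hom_of_linear => a x y; apply/rowP => i.
  by rewrite !mxE fun_of_row_linear linF.
by exists g => x; rewrite gE fun_of_row_surj.
Qed.

(** The intersection of a nonnegative subspace with the kernel of [l] loses at
    most k dimensions, and [F] maps it injectively to a nonnegative one. *)
Lemma wnorm_le_codim k (G H : wgraph) (F : (G -> R) -> (H -> R))
    (l : (G -> R) -> 'rV[R]_k) :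
  (forall h, fun_linear (fun x => F x h : R^o)) -> fun_linear l ->
  (forall x, l x = 0 -> qform x <= qform (F x)) ->
  (forall x, l x = 0 -> (forall h, F x h = 0) -> 0 <= qform x ->
     forall g, x g = 0) ->
  (wnorm R G <= wnorm R H + k)%N.
Proof.
move=> linF linl qF injF; have [f fE] := hom_of_fun_linear linF.
have [l' l'E] : exists g : 'Hom('rV[R]_#|G|, 'rV[R]_k),
    forall x, g x = l (fun_of_row x).
  by apply: hom_of_linear => a x y; rewrite fun_of_row_linear linl.
have [W [W0 dW]] := wnorm_attained G.
pose W1 := (W :&: lker l')%VS.
have W1P x : x \in W1 -> l (fun_of_row x) = 0 /\ 0 <= qform (fun_of_row x).
  rewrite memv_cap memv_ker => /andP[xW /eqP]; rewrite l'E => ->.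
  by split=> //; rewrite -wform_qform W0.
have dW1 : (wnorm R G <= \dim W1 + k)%N.
  rewrite -dW -(limg_ker_dim l' W) leq_add2l.
  by rewrite (leq_trans (dimvS (subvf _))) // dimvf /dim /= mul1n.
apply: leq_trans dW1 _; rewrite leq_add2r.
have <- : \dim (f @: W1)%VS = \dim W1.
  apply: limg_dim_eq; apply/eqP; rewrite -subv0; apply/subvP => x.
  rewrite memv_cap memv_ker memv0 => /andP[/W1P[lx qx] /eqP fx].
  apply/eqP/fun_of_row_eq0/(injF _ lx) => // h.
  by rewrite -fE fx /fun_of_row mxE.
apply: wnorm_max => y /memv_imgP[x /W1P[lx qx] ->].
by rewrite wform_qform fE (le_trans qx) ?qF.
Qed.

Lemma wnorm_le (G H : wgraph) (F : (G -> R) -> (H -> R)) :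
  (forall h, fun_linear (fun x => F x h : R^o)) ->
  (forall x, qform x <= qform (F x)) ->
  (forall x, (forall h, F x h = 0) -> 0 <= qform x -> forall g, x g = 0) ->
  (wnorm R G <= wnorm R H)%N.
Proof.
move=> linF qF injF; rewrite -[leqRHS]addn0.
apply: (@wnorm_le_codim 0 G H F (fun=> 0)) => //.
- by move=> a x y; rewrite scaler0 addr0.
- by move=> x _; apply: injF.
Qed.

(** The vector [u] is positive and can be added to the image of each
    nonnegative subspace. *)
Lemma wnorm_ge_add1 (G H : wgraph) (F : (G -> R) -> (H -> R)) (u : H -> R) :
  (forall h, fun_linear (fun x => F x h : R^o)) ->
  (forall a x, qform x + a ^+ 2 <= qform (fun h => F x h + a * u h)) ->
  (forall a x, (forall h, F x h + a * u h = 0) -> a = 0 /\ forall g, x g = 0) ->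
  (wnorm R G < wnorm R H)%N.
Proof.
move=> linF qF injF; have [f fE] := hom_of_fun_linear linF.
pose u' : 'rV[R]_#|H| := \row_i u (enum_val i).
have fun_of_rowfu a x : fun_of_row (f x + a *: u') =
    (fun h => F (fun_of_row x) h + a * u h).
  rewrite addrC fun_of_row_linear fun_of_row_surj fE.
  by apply/funext => h; rewrite addrC.
have inj a x : f x + a *: u' = 0 -> a = 0 /\ x = 0.
  move=> E0; have [h|a0 x0] := injF a (fun_of_row x).
    by rewrite -[LHS]/((fun h => F (fun_of_row x) h + a * u h) h)
       -fun_of_rowfu E0 /fun_of_row mxE.
  by split=> //; apply: fun_of_row_eq0.
have [W [W0 dW]] := wnorm_attained G.
have u'0 : u' != 0.
  apply/eqP => u0; have /inj[/eqP] : f 0 + 1 *: u' = 0; last by rewrite oner_eq0.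
  by rewrite u0 scaler0 addr0 linear0.
have <- : \dim (f @: W + <[u']>)%VS = (wnorm R G).+1.
  rewrite dimv_disjoint_sum ?dim_vline ?u'0 ?addn1 ?limg_dim_eq ?dW //.
    apply/eqP; rewrite -subv0; apply/subvP => x.
    rewrite memv_cap memv_ker memv0 => /andP[_ /eqP fx].
    have /inj[_ ->] // : f x + 0 *: u' = 0.
    by rewrite fx scale0r addr0.
  apply/eqP; rewrite -subv0; apply/subvP => y.
  rewrite memv_cap memv0 => /andP[/memv_imgP[x _ ->] /vlineP[a Ea]].
  have /inj[_ ->] : f x + (- a) *: u' = 0 by rewrite Ea scaleNr subrr.
  by rewrite linear0.
apply: wnorm_max => y /memv_addP[y1 /memv_imgP[x xW ->]] [y2 /vlineP[a ->] ->].
rewrite wform_qform fun_of_rowfu (le_trans _ (qF _ _)) //.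
by rewrite addr_ge0 ?sqr_ge0 // -wform_qform W0.
Qed.

Lemma qform_iso (G H : wgraph) (f : G -> H) : bijective f ->
  (forall x y, adj (f x) (f y) = adj x y) -> (forall x, weight (f x) = weight x) ->
  forall x : H -> R, qform (x \o f) = qform x.
Proof.
move=> bf af wf x; rewrite /qform [RHS](reindex f) /=; last exact: onW_bij.
apply: eq_bigr => u _; rewrite [RHS](reindex f) /=; last exact: onW_bij.
by apply: eq_bigr => v _; rewrite (wmat_iso bf af wf).
Qed.

Lemma wnorm_iso_le (G H : wgraph) : wg_iso G H -> (wnorm R H <= wnorm R G)%N.
Proof.
case=> f [bf af wf]; apply: (@wnorm_le _ _ (fun x => x \o f)) => //.
  by move=> x; rewrite (qform_iso bf af wf).
by case: bf => g fK gK x x0 _ h; rewrite -(gK h); apply: x0.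
Qed.

Lemma qform_blow (G : wgraph) (S : {set G}) (x : blow S -> R) : wclique S ->
  qform x = qform (x \o Some) - (x None - \sum_(u in S) x (Some u)) ^+ 2.
Proof.
move=> cS; rewrite /qform.
rewrite (big_option (fun u : blow S => \sum_v x u * (wmat u v)%:~R * x v)).
rewrite (big_option (fun v : blow S => x None * (wmat (None : blow S) v)%:~R * x v)).
rewrite wmat_blowNN.
set s := \sum_(u in S) x (Some u).
have sE : s = \sum_u (u \in S)%:R * x (Some u) by rewrite /s sum_mem_set.
have -> : \sum_v x None * (wmat (None : blow S) (Some v))%:~R * x (Some v) = x None * s.
  rewrite sE mulr_sumr; apply: eq_bigr => v _.
  by rewrite wmat_blowN mulrA; case: (v \in S).
have -> : \sum_u \sum_v x (Some u) * (wmat (Some u : blow S) v)%:~R * x v =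
    \sum_u \sum_v x (Some u) * (wmat u v)%:~R * x (Some v) + x None * s - s ^+ 2.
  rewrite {1}sE mulr_sumr expr2 {1}sE mulr_suml -big_split -sumrB /=.
  apply: eq_bigr => u _.
  rewrite (big_option (fun v : blow S => x (Some u) * (wmat (Some u : blow S) v)%:~R * x v)).
  rewrite wmat_blowN' [in RHS]sE mulr_sumr.
  rewrite -[RHS]addrA [RHS]addrCA; congr (_ + _).
     by case: (u \in S) => /=; ring.
  rewrite -sumrB; apply: eq_bigr => v _; rewrite wmat_blowS //.
  rewrite intrB; case: (u \in S); case: (v \in S) => /=; ring.
rewrite intrN; ring.
Qed.

(** One inequality comes from forgetting the new coordinate, and the other
    from the graph of the linear form \sum_(u in S) x_u, on which the negative
    square vanishes. *)
Lemma wnorm_blow (G : wgraph) (S : {set G}) :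
  wclique S -> wnorm R (blow S) = wnorm R G.
Proof.
move=> cS; apply/eqP; rewrite eqn_leq; apply/andP; split.
  apply: (@wnorm_le (blow S) G (fun x => x \o Some)) => //.
    by move=> x; rewrite qform_blow // gerBl sqr_ge0.
  move=> x x0; rewrite qform_blow //.
  have -> : x \o Some = fun=> 0 by apply/funext.
  rewrite big1 => [|u _]; last exact: x0.
  have -> : qform (fun _ : G => 0 : R) = 0.
    by rewrite /qform big1 // => u _; rewrite big1 // => v _; rewrite mulr0.
  rewrite subr0 sub0r oppr_ge0 => xN [u|]; first exact: x0.
  by apply/eqP; rewrite -sqrf_eq0 eq_le xN sqr_ge0.
pose F (x : G -> R) (h : blow S) : R := if h is Some u then x u else \sum_(u in S) x u.
apply: (@wnorm_le G (blow S) F).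
- move=> [u|] a x y //=; rewrite -[_ *: _]/(_ * _) mulr_sumr -big_split.
  by apply: eq_bigr => u _.
- by move=> x; rewrite qform_blow //= subrr expr0n subr0.
- by move=> x x0 _ u; apply: (x0 (Some u)).
Qed.

Lemma wnorm_equiv G H : wg_equiv G H -> wnorm R G = wnorm R H.
Proof.
apply: (wg_equiv_invariant (P := fun G H => wnorm R G = wnorm R H)) => {G H} //.
- by move=> G H K -> ->.
- move=> G H iso; apply/eqP; rewrite eqn_leq !wnorm_iso_le //.
  exact: wg_iso_sym.
- by move=> G S cS _; rewrite wnorm_blow.
Qed.

End Norm.

(** * Labelings and their divisors *)

Definition wdeg (G : wgraph) (u : G) : int := \sum_v (adj u v)%:R.

(** A labeling modulo d is a homomorphism to Z/dZ from the cokernel of the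
    matrix of the graph, given by integer representatives of its values. *)
Definition labeling (d : int) (G : wgraph) (f : G -> int) : Prop :=
  forall u, (d %| \sum_v wmat u v * f v)%Z.

(** The coefficient at a of the image in Z[Z/dZ] of the formal sum
    \sum_u (deg u - 2) [e_u]. *)
Definition label_divisor (d : int) (G : wgraph) (f : G -> int) (a : int) : int :=
  \sum_(u | (d %| f u - a)%Z) (wdeg u - 2).

(** The class 0 is left out since a free blowing-up adds a vertex of degree 0
    with label 0. *)
Definition label_transfer (d : int) (G H : wgraph) : Prop :=
  forall f : G -> int, labeling d f -> exists2 g : H -> int, labeling d g &
    forall a, ~~ (d %| a)%Z -> label_divisor d f a = label_divisor d g a.

Lemma label_transfer_iso d G H : wg_iso G H -> label_transfer d G H.
Proof.
move=> /wg_iso_sym[f [bf af wf]] x lx; exists (x \o f) => [u|a _].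
  have := lx (f u); rewrite (reindex f) /=; last exact: onW_bij.
  by congr (_ %| _)%Z; apply: eq_bigr => v _; rewrite (wmat_iso bf af wf).
rewrite /label_divisor (reindex f) /=; last exact: onW_bij.
apply: eq_bigr => u _; congr (_ - _).
rewrite /wdeg (reindex f) /=; last exact: onW_bij.
by apply: eq_bigr => v _; rewrite af.
Qed.

Section BlowLabel.
Variables (d : int) (G : wgraph) (S : {set G}).
Hypotheses (cS : wclique S) (S2 : (#|S| <= 2)%N).

(** The row of the new vertex forces its label to be the sum of the labels on
    [S], and with this label the other rows are those of the old graph. *)
Lemma labeling_blow (g : blow S -> int) :
  labeling d g <->
  labeling d (g \o Some) /\ (d %| g None - \sum_(u in S) g (Some u))%Z.
Proof.
have rowN : \sum_v wmat (None : blow S) v * g v =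
    - (g None - \sum_(u in S) g (Some u)).
  rewrite (big_option (fun v => wmat (None : blow S) v * g v)) wmat_blowNN.
  rewrite sum_mem_set; under eq_bigr do rewrite wmat_blowN.
  by rewrite mulN1r opprB addrC.
have rowS u : \sum_v wmat (Some u : blow S) v * g v =
    \sum_v wmat u v * g (Some v) +
    (u \in S)%:R * (g None - \sum_(u in S) g (Some u)).
  rewrite (big_option (fun v => wmat (Some u : blow S) v * g v)) wmat_blowN'.
  rewrite sum_mem_set mulrBr mulr_sumr addrCA -sumrB; congr (_ + _).
  apply: eq_bigr => v _; rewrite wmat_blowS //.
  by case: (u \in S); case: (v \in S) => /=; ring.
split=> [lg|[lg gN] [u|]].
- have gN : (d %| g None - \sum_(u in S) g (Some u))%Z.
    by have := lg None; rewrite rowN rpredN.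
  by split=> // u; have := lg (Some u); rewrite rowS rpredDr // dvdz_mull.
- by rewrite rowS rpredD ?dvdz_mull //; apply: lg.
- by rewrite rowN rpredN.
Qed.

Lemma wdeg_blowN : wdeg (None : blow S) = #|S|%:Z.
Proof.
rewrite /wdeg (big_option (fun v => (adj (None : blow S) v)%:R)) /= add0r.
by rewrite card_sum_mem.
Qed.

Lemma wdeg_blowS u :
  wdeg (Some u : blow S) = wdeg u + (u \in S)%:R * (2 - #|S|%:Z).
Proof.
rewrite /wdeg (big_option (fun v => (adj (Some u : blow S) v)%:R)) /=.
case: (boolP (u \in S)) => uS; last first.
  by rewrite mul0r addr0 add0r; apply: eq_bigr => v _; rewrite andbT.
rewrite mul1r /=; suff : \sum_v (adj u v)%:R = 
    \sum_v (adj u v && ~~ (v \in S))%:R + #|S|%:Z - 1.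
  rewrite /wdeg => ->. ring.
rewrite card_sum_mem -big_split /=.
rewrite (bigD1 u) //= [in RHS](bigD1 u) //= adj_irr uS /= !add0r.
rewrite [RHS]addrC addKr.
apply: eq_bigr => v nvu; case: (boolP (v \in S)) => vS; last by rewrite andbT addr0.
by rewrite andbF add0r cS // eq_sym.
Qed.

(** If S = {v}, the new vertex has the label of v, and its contribution -1
    compensates the increase of the degree of v; if S is an edge, the new
    vertex has degree 2 and the other degrees do not change. *)
Lemma label_divisor_blow (g : blow S -> int) a :
  (d %| g None - \sum_(u in S) g (Some u))%Z -> ~~ (d %| a)%Z ->
  label_divisor d g a = label_divisor d (g \o Some) a.
Proof.
move=> gN a0; rewrite /label_divisor !(big_mkcond (fun u => _ %| _)%Z) /=.
rewrite (big_option (fun u : blow S => if (d %| g u - a)%Z then wdeg u - 2 else 0)).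
rewrite wdeg_blowN.
have -> : (d %| g None - a)%Z = (d %| \sum_(u in S) g (Some u) - a)%Z.
  by rewrite -[RHS](rpredDr _ gN); congr (_ %| _)%Z; ring.
have [k k2 Ek] : exists2 k, (k <= 2)%N & #|S| = k by exists #|S|.
case: k k2 Ek => [|[|[|//]]] _ Ek; rewrite Ek.
- move/eqP: Ek; rewrite cards_eq0 => /eqP S0.
  rewrite {1}S0 big_set0 sub0r rpredN (negPf a0) add0r.
  by apply: eq_bigr => u _; rewrite wdeg_blowS S0 finset.inE mul0r addr0.
- move/eqP: Ek => /cards1P[v Sv]; rewrite {1}Sv big_set1.
  rewrite (bigD1 v) //= [RHS](bigD1 v) //= addrA; congr (_ + _).
     by rewrite wdeg_blowS Sv cards1 finset.inE eqxx; case: ifP => // _; rewrite mul1r; lia.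
  by apply: eq_bigr => u nuv; rewrite wdeg_blowS Sv finset.inE (negPf nuv) mul0r addr0.
- rewrite subrr if_same add0r.
  by apply: eq_bigr => u _; rewrite wdeg_blowS Ek subrr mulr0 addr0.
Qed.

Lemma label_transfer_blow : label_transfer d G (blow S) /\ label_transfer d (blow S) G.
Proof.
split=> [f lf|g /labeling_blow[lg gN]].
  pose g (u : blow S) := if u is Some v then f v else \sum_(u in S) f u.
  have gN : (d %| g None - \sum_(u in S) g (Some u))%Z by rewrite /= subrr dvdz0.
  exists g => [|a a0]; first by apply/labeling_blow.
  by rewrite (label_divisor_blow gN a0).
by exists (g \o Some) => // a a0; rewrite (label_divisor_blow gN a0).
Qed.

End BlowLabel.

Lemma label_transfer_equiv d G H : wg_equiv G H -> label_transfer d G H.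
Proof.
have T G1 G2 G3 : label_transfer d G1 G2 -> label_transfer d G2 G3 -> label_transfer d G1 G3.
  move=> l12 l23 f /l12[g /l23[h lh Eh] Eg].
  by exists h => // a a0; rewrite Eg // Eh.
move=> GH; suff [] : label_transfer d G H /\ label_transfer d H G by [].
move: G H GH; apply: wg_equiv_invariant.
- by move=> G; split; apply/label_transfer_iso/wg_iso_refl.
- by move=> G H [].
- by move=> G H K [GH HG] [HK KH]; split; [apply: T GH HK | apply: T KH HG].
- by move=> G H iso; split; apply: label_transfer_iso => //; apply: wg_iso_sym.
- exact: label_transfer_blow.
Qed.

(** * Blowing up chains *)

(** The weights of the chain obtained by inserting the new vertex at position
    k: this is a blowing-up at an end if k is 0 or the length, at an edge in
    between, and the free one for the empty chain. *)
Fixpoint insblow (k : nat) (X : seq int) : seq int :=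
  match X, k with
  | [::], _ => [:: -1]
  | a :: X', 0%N => [:: -1, a - 1 & X']
  | a :: X', k'.+1 => (if k' is 0%N then a - 1 else a) :: insblow k' X'
  end.

Lemma size_insblow k X : size (insblow k X) = (size X).+1.
Proof. by elim: X k => [|a X IH] [|k] //=; rewrite IH. Qed.

Lemma nth_insblow_new k X : (k <= size X)%N -> (insblow k X)`_k = -1.
Proof. by elim: X k => [|a X IH] [|k] //=; rewrite ltnS; apply: IH. Qed.

Lemma nth_insblow_old k X i : (i < size X)%N ->
  (insblow k X)`_(bump k i) = X`_i - ((i.+1 == k) || (i == k))%:R.
Proof.
elim: X k i => [|a X IH] [|k] [|i] //=; first by rewrite subr0.
  by case: k => [|k] //=; rewrite subr0.
by rewrite ltnS => /IH <-; rewrite bumpS.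
Qed.

Definition slot (k : nat) (X : seq int) : {set chain X} :=
  [set i : chain X | ((i : 'I_(size X)).+1 == k) || ((i : 'I_(size X)) == k :> nat)]%SET.

Lemma in_slot k X (i : chain X) :
  (i \in slot k X) =
  (((i : 'I_(size X)).+1 == k) || ((i : 'I_(size X)) == k :> nat)).
Proof. by rewrite finset.inE. Qed.

Lemma insblow_iso k X : (k <= size X)%N ->
  wg_iso (blow (slot k X)) (chain (insblow k X)).
Proof.
move=> kX.
have ltk : (k < size (insblow k X))%N by rewrite size_insblow.
have lti (i : 'I_(size X)) : (bump k i < size (insblow k X))%N.
  by rewrite size_insblow /bump; have := ltn_ord i; case: (k <= i)%N; lia.
pose f (x : blow (slot k X)) : chain (insblow k X) :=
  if x is Some i then Ordinal (lti i) else Ordinal ltk.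
exists f; split.
- apply: inj_card_bij.
    move=> [i|] [j|] /(congr1 val) /=.
    + by move/(can_inj (bumpK k))/val_inj => ->.
    + by move=> E; have := neq_bump k i; rewrite E eqxx.
    + by move=> E; have := neq_bump k j; rewrite -E eqxx.
    + by [].
  by rewrite card_option !card_ord size_insblow.
- move=> [i|] [j|]; rewrite /= /chain_adj /= ?in_slot /bump.
  + by case: (leqP k i); case: (leqP k j) => /= ? ?; lia.
  + by case: (leqP k i) => /= ?; lia.
  + by case: (leqP k j) => /= ?; lia.
  + by lia.
- move=> [i|]; rewrite /= ?nth_insblow_new // nth_insblow_old // in_slot.
  by case: ifP; rewrite ?subr0.
Qed.

Lemma insblow_blowing_up k X : (k <= size X)%N ->
  blowing_up (chain X) (chain (insblow k X)).
Proof.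
move=> kX; have iso := insblow_iso kX.
case: k kX iso => [|k] kX iso.
  case: (posnP (size X)) => [X0|X0].
    apply: BlowFree; rewrite (_ : finset.set0 = slot 0 X) //.
    by apply/setP => -[i /= ltiX]; exfalso; rewrite X0 in ltiX.
  apply: (@BlowVertex (chain X) _ (Ordinal X0)).
  rewrite (_ : [set _]%SET = slot 0 X) //.
  by apply/setP => i; rewrite in_slot finset.inE.
case: (ltnP k.+1 (size X)) => [ltX|geX].
  apply: (@BlowEdge (chain X) _ (Ordinal kX) (Ordinal ltX)).
    by rewrite /= /chain_adj /= eqxx.
  rewrite (_ : [set _; _]%SET = slot k.+1 X) //.
  by apply/setP => i; rewrite in_slot !finset.inE.
apply: (@BlowVertex (chain X) _ (Ordinal kX)).
rewrite (_ : [set _]%SET = slot k.+1 X) //.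
apply/setP => i; rewrite in_slot !finset.inE -val_eqE /= eqSS.
by have := ltn_ord i; lia.
Qed.

Definition seqstep X Y := exists2 k, (k <= size X)%N & Y = insblow k X.
Definition seq_equiv : seq int -> seq int -> Prop :=
  clos_refl_sym_trans (seq int) seqstep.

Lemma seq_equiv_chain X Y : seq_equiv X Y -> wg_equiv (chain X) (chain Y).
Proof.
elim=> {X Y} [X Y [k kX ->]|X|X Y _|X Y Z _ XY _ YZ].
- by apply: rst_step; apply: insblow_blowing_up.
- exact: rst_refl.
- exact: rst_sym.
- exact: rst_trans XY YZ.
Qed.

Lemma chain_rev_iso X : wg_iso (chain (rev X)) (chain X).
Proof.
pose f (i : chain (rev X)) : chain X := rev_ord (cast_ord (size_rev X) i).
have lti (i : 'I_(size (rev X))) : (i < size X)%N by rewrite -(size_rev X).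
exists f; split.
- apply: inj_card_bij; last by rewrite !card_ord size_rev.
  by move=> i j /rev_ord_inj/cast_ord_inj.
- by move=> i j; rewrite /= /chain_adj /=; have := lti i; have := lti j; lia.
- by move=> i; rewrite /= nth_rev // lti.
Qed.

(** * Continuants *)

(** The expansion of the tridiagonal determinant along its first row. *)
Fixpoint continuant (X : seq int) : int :=
  if X is a :: X' then
    - a * continuant X' - (if X' is _ :: X'' then continuant X'' else 0)
  else 1.

Definition continuant1 (X : seq int) : int := if X is _ :: X' then continuant X' else 0.

Lemma continuant_cons a X : continuant (a :: X) = - a * continuant X - continuant1 X.
Proof. by []. Qed.

Lemma continuant1_cons a X : continuant1 (a :: X) = continuant X.
Proof. by []. Qed.

Definition chain_wt (X : seq int) (i j : nat) : int :=
  if i == j then X`_i else ((i.+1 == j) || (j.+1 == i))%:R.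

Lemma chain_wtS a X i j : chain_wt (a :: X) i.+1 j.+1 = chain_wt X i j.
Proof. by rewrite /chain_wt !eqSS. Qed.

Definition tridiag n (X : seq int) : 'M[int]_n := \matrix_(i, j) - chain_wt X i j.

Lemma det_tridiag2 n a b X :
  \det (tridiag n.+2 [:: a, b & X]) =
  - a * \det (tridiag n.+1 (b :: X)) - \det (tridiag n X).
Proof.
rewrite (expand_det_row _ ord0) 2!big_ord_recl [X in _ + (_ + X)]big1; last first.
  by move=> i _; rewrite !mxE /chain_wt /= oppr0 mul0r.
rewrite addr0 !mxE /chain_wt /=; congr (_ * _ + _).
  rewrite /cofactor expr0 mul1r; congr (\det _); apply/matrixP => i j.
  by rewrite !mxE chain_wtS.
rewrite /cofactor expr1 mulrA mulrNN mul1r.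
rewrite (expand_det_col _ ord0) big_ord_recl big1; last first.
  by move=> i _; rewrite !mxE /chain_wt /= oppr0 mul0r.
rewrite addr0 !mxE /chain_wt /= mulN1r /cofactor expr0 mul1r; congr (- \det _).
by apply/matrixP => i j; rewrite !mxE -[in RHS](chain_wtS b) -[in RHS](chain_wtS a).
Qed.

Lemma det0_continuant X : Defs.det0 X = continuant X.
Proof.
have -> : Defs.det0 X = \det (tridiag (size X) X).
  rewrite /Defs.det0 (wdetE (e := id : 'I_(size X) -> chain X)); last by exists id.
  by [].
have [n leXn] := ubnP (size X); elim: n X leXn => // n IH [|a [|b X]] /= ltXn.
- by rewrite det_mx00.
- by rewrite det_mx11 mxE /chain_wt /= mulr1 subr0.
- have E1 := IH (b :: X) ltXn; have E2 := IH X (ltnW ltXn).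
  by rewrite det_tridiag2 [\det (tridiag (size X).+1 _)]E1 E2.
Qed.

Lemma det1_continuant1 X : Defs.det1 X = continuant1 X.
Proof. by case: X => //= a X; apply: det0_continuant. Qed.

(** Only the insertion at the left end changes [continuant1], and it does so
    by the determinant. *)
Lemma continuant_insblow k X : (k <= size X)%N ->
  continuant (insblow k X) = continuant X /\
  continuant1 (insblow k X) = continuant1 X + (k == 0%N)%:R * continuant X.
Proof.
elim: X k => [|a X IH] [|k] //.
- move=> _; rewrite eqxx mul1r [insblow _ _]/=.
  by rewrite !continuant_cons !continuant1_cons !continuant_cons; split; ring.
- rewrite [insblow _ _]/= continuant_cons continuant1_cons; move=> /IH[-> ->].
  rewrite continuant_cons continuant1_cons; case: k => [|k] /=; split; ring.
Qed.

Lemma seq_equiv_continuant X Y : seq_equiv X Y -> continuant X = continuant Y.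
Proof.
elim=> {X Y} [X Y [k kX ->]|X|X Y _|X Y Z _ XY _ YZ] //; last by rewrite XY.
by have [-> _] := continuant_insblow kX.
Qed.

Lemma seq_equiv_continuant1 X Y : seq_equiv X Y ->
  (continuant X %| continuant1 X - continuant1 Y)%Z.
Proof.
elim=> {X Y} [X Y [k kX ->]|X|X Y XY|X Y Z XY XYd YZ].
- have [_ ->] := continuant_insblow kX.
  by rewrite opprD addrA subrr sub0r rpredN dvdz_mull.
- by rewrite subrr dvdz0.
- by rewrite (seq_equiv_continuant XY) -opprB rpredN.
- rewrite -(seq_equiv_continuant XY) => YZd.
  by have := rpredD XYd YZd; rewrite addrA subrK.
Qed.

(** * Linear chains as sequences *)

(** A simple path that misses some vertex can be extended: by connectedness
    some w in the path has a neighbour outside it, and w is an end of the path,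
    as otherwise its degree would be 3. *)
Lemma exists_wg_path (G : wgraph) : linear_chain G ->
  forall n, (n <= #|G|)%N ->
  exists s : seq G, [/\ size s = n, uniq s & sorted (@adj G) s].
Proof.
case=> -[conn acyc] deg2; elim=> [|n IH] ltnG; first by exists [::].
have [s [sz us ss]] := IH (ltnW ltnG).
have [w ws|s0] := pickP (mem s); last first.
  have /card_gt0P[x _] : (0 < #|G|)%N by apply: leq_ltn_trans ltnG.
  exists [:: x]; split=> //.
  by rewrite -sz; case: s s0 {sz us ss} => // y s /(_ y); rewrite /= mem_head.
have {}ws : w \in s by [].
have [x xs] : exists x, x \notin s.
  apply/existsP; rewrite -negb_forall; apply: contraL ltnG => /forallP sall.
  rewrite -leqNgt -sz -(card_uniqP us); apply/subset_leq_card/fintype.subsetP.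
  by move=> y _; apply: sall.
have [u [v [us' vs auv]]] : exists u v, [/\ u \notin s, v \in s & adj v u].
  have /connectP[p pth Ex] := conn w x.
  elim: p w ws pth Ex => [|z p IHp] w ws /=; first by move=> _ xw; rewrite xw ws in xs.
  case/andP => awz pth Ex; have [zs|zs] := boolP (z \in s).
    exact: (IHp z).
  by exists z, w.
case/splitPr: vs us ss sz us' {ws xs} => s1 s2 us ss sz us'.
case: (lastP s1) us ss sz us' => [|s1' a] us ss sz us'.
  exists [:: u, v & s2]; split; rewrite /= -?sz //.
    by move: us us' => /= -> ->.
  by rewrite adj_sym auv.
case: s2 us ss sz us' => [|b s2] us ss sz us'.
  exists (rcons (rcons s1' a ++ [:: v]) u); split.
  - by rewrite size_rcons sz.
  - by rewrite rcons_uniq us'.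
  - move: ss; case: s1' {us sz us'} => [|c s1'] /= ss.
      by rewrite auv; move: ss => /= ->.
    rewrite rcons_path ss /= last_cat /=; exact: auv.
exfalso; have := deg2 v; apply/negP; rewrite -ltnNge.
have ava : adj v a.
  move: ss; rewrite cat_rcons; case: (s1') => [|c s1''] /=.
    by rewrite adj_sym => /andP[].
  by rewrite cat_path /= => /and3P[_ _ /andP[]]; rewrite adj_sym.
have avb : adj v b.
  move: ss; rewrite cat_rcons; case: (s1') => [|c s1''] /=.
    by move=> /and3P[].
  by rewrite cat_path /= => /and5P[].
have : uniq [:: u; a; b].
  move: us us'; rewrite cat_rcons cat_uniq mem_cat !inE !negb_or /=.
case/and3P => _ _ /and4P[+ _ _ _] /and5P[_ ua _ ub _].
  by rewrite !inE !negb_or => /and3P[_ nab _]; rewrite ua ub nab.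
move/card_uniqP => /= <-; apply/subset_leq_card/fintype.subsetP => y.
by rewrite !finset.inE => /or3P[] /eqP->.
Qed.

(** A simple path through all the vertices gives the isomorphism: an edge
    between two vertices that are not consecutive would close a cycle. *)
Lemma linear_chain_iso (G : wgraph) : linear_chain G ->
  exists X : seq int, wg_iso (chain X) G.
Proof.
move=> lG; have [s [sz us ss]] := exists_wg_path lG (leqnn _).
have [[_ acyc] _] := lG.
exists (map (@weight G) s).
have szm : size (map (@weight G) s) = size s by rewrite size_map.
case: s sz us ss szm => [|x0 s] sz us ss szm.
  have G0 (x : G) : False by have := fintype0 x (esym sz).
  exists (fun i : chain [::] =>
    match (i : 'I_0) with Ordinal m lt_m => False_rect _ (notF lt_m) end).
  by split; [exists (fun x => False_rect _ (G0 x)); [case | move=> x; case: (G0 x)] | case | case].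
pose f (i : chain (map (@weight G) (x0 :: s))) : G :=
  nth x0 (x0 :: s) (i : 'I_(size (map (@weight G) (x0 :: s)))).
have ltS (i : chain (map (@weight G) (x0 :: s))) :
  ((i : 'I_(size (map (@weight G) (x0 :: s)))) < size (x0 :: s))%N.
  by rewrite -szm.
have adjnext i : (i.+1 < size (x0 :: s))%N ->
    adj (nth x0 (x0 :: s) i) (nth x0 (x0 :: s) i.+1).
  by move=> lti; apply: (pathP x0 ss).
have adjfar i j : (i.+1 < j)%N -> (j < size (x0 :: s))%N ->
    adj (nth x0 (x0 :: s) i) (nth x0 (x0 :: s) j) = false.
  move=> ltij ltj; apply/negP => aij.
  pose c := take (j - i).+1 (drop i (x0 :: s)).
  have szc : size c = (j - i).+1.
    by rewrite size_takel // size_drop; lia.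
  apply: (acyc c); first by rewrite szc; lia.
  have nthc k : (k <= j - i)%N -> nth x0 c k = nth x0 (x0 :: s) (i + k).
    by move=> lek; rewrite nth_take ?ltnS // nth_drop.
  apply/andP; split; last by rewrite take_uniq ?drop_uniq.
  case Ec : c szc nthc => [|y c'] //= [szc'] nthc.
  rewrite rcons_path; apply/andP; split.
    apply/(pathP x0) => k ltk; rewrite -[nth _ c' k]/(nth x0 (y :: c') k.+1).
    rewrite !nthc; try lia.
    by rewrite addnS adjnext //; lia.
  rewrite (last_nth x0) szc' nthc // subnKC; last by lia.
  by rewrite -[y]/(nth x0 (y :: c') 0) nthc // addn0 adj_sym.
exists f; split.
- apply: inj_card_bij; last by rewrite card_ord szm sz.
  move=> i j /eqP; rewrite /f nth_uniq ?ltS // => /eqP; exact: val_inj.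
- move=> i j; rewrite /f /= /chain_adj.
  have := ltS i; have := ltS j.
  set m := nat_of_ord i; set n := nat_of_ord j => ltn ltm.
  case: (ltngtP m n) => [mn|nm|->]; last by rewrite adj_irr; lia.
    case: (ltngtP m.+1 n) => [lt|gt|E]; [|lia|].
      by rewrite adjfar //; lia.
    by rewrite -E adjnext // E.
  rewrite adj_sym; case: (ltngtP n.+1 m) => [lt|gt|E]; [|lia|].
    by rewrite adjfar //; lia.
  by rewrite -E adjnext ?E // orbT.
- by move=> i; exact: (esym (nth_map x0 0 (@weight G) (ltS i))).
Qed.

(** * The quadratic form of a chain *)

Section ChainForm.
Variable R : realType.

Lemma sum_pick (A : pzRingType) (n : nat) (y : nat -> A) (k : nat) :
  \sum_(j < n) (k == j :> nat)%:R * y j = if (k < n)%N then y k else 0.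
Proof.
case: ltnP => [ltk|gek].
  rewrite (bigD1 (Ordinal ltk)) //=  eqxx mul1r big1 ?addr0 // => j.
  by rewrite -val_eqE /= eq_sym => /negPf ->; rewrite mul0r.
rewrite big1 // => j _; rewrite (_ : (k == j) = false) ?mul0r //.
by have := ltn_ord j; lia.
Qed.

(** Coordinates indexed by all natural numbers make the recursion on chains
    uniform at the right end. *)
Definition extend0 (A : zmodType) n (x : 'I_n -> A) (k : nat) : A :=
  if insub k is Some i then x i else 0.

Lemma extend0_ord (A : zmodType) n (x : 'I_n -> A) (i : 'I_n) : extend0 x i = x i.
Proof. by rewrite /extend0 valK. Qed.

Lemma extend0_out (A : zmodType) n (x : 'I_n -> A) k : (n <= k)%N -> extend0 x k = 0.
Proof. by move=> nk; rewrite /extend0 insubF // ltnNge nk. Qed.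

Lemma extend0_restrict (A : zmodType) n (y : nat -> A) k :
  extend0 (fun i : 'I_n => y i) k = if (k < n)%N then y k else 0.
Proof.
case: ltnP => [ltk|/extend0_out//].
by rewrite -[k]/(val (Ordinal ltk)) extend0_ord.
Qed.

Fixpoint chain_form (X : seq int) (y : nat -> R) : R :=
  if X is a :: X' then
    a%:~R * y 0%N ^+ 2 + 2 * (y 0%N * y 1%N) + chain_form X' (y \o S)
  else 0.

Lemma sum_chain_form (X : seq int) (y : nat -> R) :
  (forall k, (size X <= k)%N -> y k = 0) ->
  \sum_(i < size X) \sum_(j < size X) y i * (chain_wt X i j)%:~R * y j =
  chain_form X y.
Proof.
elim: X y => [|a X IH] y y0; first by rewrite big_ord0.
have row0 : \sum_(j < size X) y 0%N * (chain_wt (a :: X) 0 j.+1)%:~R * y j.+1 =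
    y 0%N * y 1%N.
  have -> : y 1%N = \sum_(j < size X) (0%N == j)%:R * y j.+1.
    by rewrite (sum_pick _ (y \o S)); case: ltnP => //= X0; rewrite y0.
  rewrite mulr_sumr; apply: eq_bigr => j _.
  by rewrite -mulrA /chain_wt /= orbF eqSS eq_sym; case: eqP.
rewrite /= big_ord_recl big_ord_recl /= row0 -IH => [|k lek]; last exact: y0.
have -> : \sum_(i < size X) \sum_(j < (size X).+1)
      y (lift ord0 i) * (chain_wt (a :: X) (lift ord0 i) j)%:~R * y j =
    y 0%N * y 1%N +
    \sum_(i < size X) \sum_(j < size X) (y \o S) i * (chain_wt X i j)%:~R * (y \o S) j.
  rewrite -row0 -big_split; apply: eq_bigr => i _.
  rewrite big_ord_recl; congr (_ + _).
    have -> : chain_wt (a :: X) (lift ord0 i) (ord0 : 'I_(size X).+1) =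
        chain_wt (a :: X) 0 i.+1 by rewrite /chain_wt /= orbF.
    by rewrite /=; ring.
rewrite /chain_wt /=; ring.
Qed.

Lemma qform_chain (X : seq int) (x : chain X -> R) :
  qform x = chain_form X (extend0 (x : 'I_(size X) -> R)).
Proof.
rewrite -sum_chain_form => [|k]; last exact: extend0_out.
by apply: eq_bigr => i _; apply: eq_bigr => j _; rewrite !extend0_ord.
Qed.

Lemma eq_chain_form X (y z : nat -> R) : y =1 z -> chain_form X y = chain_form X z.
Proof. by move=> /funext ->. Qed.

Lemma chain_form0 X : chain_form X (fun=> 0) = 0.
Proof.
elim: X => //= a X IH; rewrite (eq_chain_form _ (z := fun=> 0)) // IH; ring.
Qed.

Definition reduced (Z : seq int) := all (fun z => z <= -2) Z.

(** Completing the square: if a <= -2, then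
    a y_0^2 + 2 y_0 y_1 - y_1^2 <= - y_0^2 - (y_0 - y_1)^2. *)
Lemma reduced_chain_form Z (y : nat -> R) : reduced Z ->
  (forall k, (size Z <= k)%N -> y k = 0) ->
  chain_form Z y <= - y 0%N ^+ 2 /\
  (0 <= chain_form Z y -> forall k, y k = 0).
Proof.
elim: Z y => [|a Z IH] y; first by move=> _ y0; split=> [|_ k]; rewrite y0 // expr0n oppr0.
case/andP => a2 rZ y0 /=.
have [le1 def1] := IH (y \o S) rZ (fun k lek => y0 k.+1 lek).
have a2R : (a%:~R : R) <= -2 by rewrite -[- 2]/((-2)%:~R) ler_int.
have lea : a%:~R * y 0%N ^+ 2 <= -2 * y 0%N ^+ 2.
  by rewrite ler_wpM2r ?sqr_ge0.
have le2 : a%:~R * y 0%N ^+ 2 + 2 * (y 0%N * y 1%N) + chain_form Z (y \o S) <=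
   - y 0%N ^+ 2 - (y 0%N - y 1%N) ^+ 2.
  by move: le1 => /=; lra.
split=> [|ge0].
  by apply: le_trans le2 _; rewrite gerBl sqr_ge0.
have y00 : y 0%N = 0.
  apply/eqP; rewrite -sqrf_eq0 eq_le sqr_ge0 andbT.
  have := le_trans ge0 le2; have := sqr_ge0 (y 0%N - y 1%N); lra.
move: ge0; rewrite y00 expr0n /= mulr0 mul0r mulr0 !add0r => /def1 yS.
by case=> // k; apply: (yS k).
Qed.

Lemma wnorm_reduced Z : reduced Z -> wnorm R (chain Z) = 0%N.
Proof.
move=> rZ; apply/eqP; rewrite -leqn0.
have [W [W0 <-]] := wnorm_attained R (chain Z).
rewrite leqn0 dimv_eq0 -subv0; apply/subvP => x /W0.
rewrite wform_qform qform_chain => ge0; rewrite memv0; apply/eqP/rowP => i.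
have [_ /(_ ge0) z0] := reduced_chain_form rZ (@extend0_out _ _ (fun_of_row x : 'I_(size Z) -> R)).
have := z0 (nat_of_ord (enum_val i : chain Z)).
by rewrite extend0_ord /fun_of_row enum_valK mxE.
Qed.

Lemma wnorm_zero : wnorm R (chain [:: 0]) = 1%N.
Proof.
apply/eqP; rewrite eqn_leq; apply/andP; split.
  have [W [_ <-]] := wnorm_attained R (chain [:: 0]).
  by rewrite (leq_trans (dimvS (subvf W))) // dimvf /dim /= mul1n card_ord.
have <- : \dim (fullv : {vspace 'rV[R]_#|chain [:: 0]|}) = 1%N.
  by rewrite dimvf /dim /= mul1n card_ord.
apply: wnorm_max => x _; rewrite wform_qform qform_chain /=.
by rewrite (extend0_out _ (k := 1)) // mul0r !mulr0 !addr0.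
Qed.

(** The form of 0, 0, Y is 2 x_1 (x_0 + x_2) + Q_Y(x_2, x_3, ...), the sum of a
    hyperbolic plane and of the form of Y. *)
Lemma wnorm_zero_pair Y :
  wnorm R (chain [:: 0, 0 & Y]) = (wnorm R (chain Y)).+1.
Proof.
apply/eqP; rewrite eqn_leq; apply/andP; split.
  rewrite -addn1.
  (* On the hyperplane x_0 + x_1 + x_2 = 0 the hyperbolic part is - 2 x_1^2. *)
  pose F (x : chain [:: 0, 0 & Y] -> R) (i : chain Y) : R :=
    x (lift ord0 (lift ord0 (i : 'I_(size Y))) : 'I_(size Y).+2).
  pose l (x : chain [:: 0, 0 & Y] -> R) : 'rV[R]_1 :=
    \row__ (extend0 (x : 'I_(size Y).+2 -> R) 0 + extend0 (x : 'I_(size Y).+2 -> R) 1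
            + extend0 (x : 'I_(size Y).+2 -> R) 2).
  have extF x : extend0 (x : 'I_(size Y).+2 -> R) \o S \o S =1
      extend0 (F x : 'I_(size Y) -> R).
    move=> k /=; case: (ltnP k (size Y)) => [ltk|gek]; last by rewrite !extend0_out.
    rewrite -[k]/(val (Ordinal ltk)) extend0_ord /F -extend0_ord.
    by [].
  have extD a (x y : chain [:: 0, 0 & Y] -> R) k :
      extend0 ((fun t => a * x t + y t) : 'I_(size Y).+2 -> R) k =
      a * extend0 (x : 'I_(size Y).+2 -> R) k + extend0 (y : 'I_(size Y).+2 -> R) k.
    by rewrite /extend0; case: insub => // ; rewrite mulr0 addr0.
  have qF x : l x = 0 -> qform x =
      qform (F x) - 2 * (extend0 (x : 'I_(size Y).+2 -> R) 1) ^+ 2.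
    move=> /rowP/(_ ord0); rewrite !mxE !qform_chain /= => lx.
    rewrite (eq_chain_form _ (extF x)) /=; move: lx.
    set x0 := extend0 _ 0; set x1 := extend0 _ 1; set x2 := extend0 _ 2 => lx.
    have -> : x0 = - x1 - x2 by lra.
    ring.
  apply: (@wnorm_le_codim _ _ _ _ F l).
  - by move=> h a x y.
  - by move=> a x y; apply/rowP => i; rewrite !mxE !extD; ring.
  - by move=> x /qF ->; rewrite gerBl mulr_ge0 ?sqr_ge0.
  - move=> x lx Fx0; rewrite qF // qform_chain.
    rewrite (eq_chain_form _ (z := fun=> 0)); last first.
      by move=> k; rewrite /extend0; case: insub => // i; apply: Fx0.
    rewrite chain_form0 sub0r oppr_ge0 => x1le.
    have x1 : extend0 (x : 'I_(size Y).+2 -> R) 1 = 0.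
      by apply/eqP; rewrite -sqrf_eq0 eq_le sqr_ge0 andbT; lra.
    have x2 : extend0 (x : 'I_(size Y).+2 -> R) 2 = 0.
      by have := extF x 0%N; rewrite /= => ->; rewrite /extend0; case: insub => // i; apply: Fx0.
    have x0 : extend0 (x : 'I_(size Y).+2 -> R) 0 = 0.
      by move/rowP/(_ ord0): lx; rewrite !mxE x1 x2 !addr0.
    move=> g; rewrite -(extend0_ord (x : 'I_(size Y).+2 -> R) g).
    case: (nat_of_ord g) => [|[|k]] //.
    have := extF x k; rewrite /= => ->; rewrite /extend0; case: insub => // i; exact: Fx0.
(* Y is embedded with x_0 = - x_2 and x_1 = 0, and u = (1, 1, 0, ...) is the
   positive vector of the hyperbolic plane. *)
pose Fn (x : chain Y -> R) (k : nat) : R :=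
  if k is k'.+1 then (if k' is k''.+1 then extend0 (x : 'I_(size Y) -> R) k'' else 0)
  else - extend0 (x : 'I_(size Y) -> R) 0.
pose un (k : nat) : R := (k < 2)%:R.
pose F (x : chain Y -> R) (i : chain [:: 0, 0 & Y]) : R := Fn x (i : 'I_(size Y).+2).
pose u (i : chain [:: 0, 0 & Y]) : R := un (i : 'I_(size Y).+2).
have extF a x : extend0 ((fun h => F x h + a * u h) : 'I_(size Y).+2 -> R) =1
    (fun k => Fn x k + a * un k).
  move=> k; rewrite (extend0_restrict _ (fun k => Fn x k + a * un k)).
  case: ltnP => //; case: k => [|[|k]] //= gek.
  by rewrite extend0_out // mulr0 addr0.
apply: (@wnorm_ge_add1 _ _ _ F u).
- move=> [[|[|k]] ltk] a x y; rewrite /F /= /extend0.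
  + by case: insub => [i|]; rewrite /= -[_ *: _]/(_ * _); ring.
  + by rewrite -[_ *: _]/(_ * _); ring.
  + by case: insub => [i|]; rewrite /= -[_ *: _]/(_ * _); ring.
- move=> a x; rewrite !qform_chain (eq_chain_form _ (extF a x)) /= /un /=.
  rewrite [X in _ <= _ + (_ + X)](eq_chain_form _
    (z := extend0 (x : 'I_(size Y) -> R))); last first.
    by move=> k; rewrite /= mulr0 addr0.
  set z := extend0 _ 0; have := sqr_ge0 a; lra.
- move=> a x Fx0.
  have FE k : Fn x k + a * un k = 0.
    rewrite -extF /extend0; case: insub => // i; exact: Fx0.
  have a0 : a = 0 by have := FE 1%N; rewrite /= add0r mulr1.
  split=> // g; have := FE (g : 'I_(size Y)).+2.
  by rewrite /= mulr0 addr0 extend0_ord.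
Qed.

End ChainForm.

(** * The normal form of a chain *)

Lemma insblow_cat A k X : insblow (size A + k.+1) (A ++ X) = A ++ insblow k.+1 X.
Proof.
elim: A => //= a A <-; congr (_ :: _).
by case E : (size A + k.+1)%N => //; exfalso; lia.
Qed.

Lemma seq_equiv_insblow A k X : (k < size X)%N ->
  seq_equiv (A ++ X) (A ++ insblow k.+1 X).
Proof.
move=> kX; apply: rst_step; exists (size A + k.+1)%N; last by rewrite insblow_cat.
by rewrite size_cat leq_add2l.
Qed.

Lemma seq_equiv_insblow0 X : seq_equiv X (insblow 0 X).
Proof. by apply: rst_step; exists 0%N. Qed.

Lemma seq_equiv_refl X : seq_equiv X X.
Proof. exact: rst_refl. Qed.
Lemma seq_equiv_sym X Y : seq_equiv X Y -> seq_equiv Y X.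
Proof. exact: rst_sym. Qed.
Lemma seq_equiv_trans Y X Z : seq_equiv X Y -> seq_equiv Y Z -> seq_equiv X Z.
Proof. exact: rst_trans. Qed.

Lemma int_step_equiv (f : int -> seq int) :
  (forall n, seq_equiv (f n) (f (n + 1))) -> forall m n, seq_equiv (f m) (f n).
Proof.
move=> step.
have up m (k : nat) : seq_equiv (f m) (f (m + k%:Z)).
  elim: k => [|k IH]; first by rewrite addr0; apply: seq_equiv_refl.
  by apply: seq_equiv_trans IH _; rewrite -addn1 PoszD addrA.
move=> m n; case: (leP m n) => mn.
  by have := up m `|n - m|%N; rewrite (_ : m + _ = n) //; lia.
apply: seq_equiv_sym.
by have := up n `|m - n|%N; rewrite (_ : n + _ = m) //; lia.
Qed.

(** Both sides of one unit step, after blowing up the edge on one side of the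
    entry 0, become a, -1, -1, b - 1. *)
Lemma zero_shift A a b B n :
  seq_equiv (A ++ [:: a, 0, b & B]) (A ++ [:: a + n, 0, b - n & B]).
Proof.
pose f n := A ++ [:: a + n, 0, b - n & B].
suff : seq_equiv (f 0) (f n) by rewrite /f subr0 addr0.
apply: int_step_equiv => {}n; rewrite /f.
apply: seq_equiv_trans (seq_equiv_insblow A (k := 1) _) _ => //.
apply/seq_equiv_sym; apply: seq_equiv_trans (seq_equiv_insblow A (k := 0) _) _ => //=.
by rewrite addrA addrK opprD addrA sub0r; apply: seq_equiv_refl.
Qed.

Lemma zero_shiftl b c B : seq_equiv [:: 0, b & B] [:: 0, c & B].
Proof.
apply: (int_step_equiv (f := fun n => [:: 0, n & B])) => n.
apply/seq_equiv_sym; apply: seq_equiv_trans (seq_equiv_insblow [::] (k := 0) _) _ => //=.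
apply/seq_equiv_sym; apply: seq_equiv_trans (seq_equiv_insblow0 _) _ => /=.
by rewrite addrK sub0r; apply: seq_equiv_refl.
Qed.

Lemma zero_shiftr A a b : seq_equiv (A ++ [:: a; 0]) (A ++ [:: b; 0]).
Proof.
apply: (int_step_equiv (f := fun n => A ++ [:: n; 0])) => n.
apply: seq_equiv_trans (seq_equiv_insblow A (k := 1) _) _ => //=.
apply/seq_equiv_sym; apply: seq_equiv_trans (seq_equiv_insblow A (k := 0) _) _ => //=.
by rewrite addrK sub0r; apply: seq_equiv_refl.
Qed.

Lemma zero_pair_front A B : exists Y, seq_equiv (A ++ [:: 0, 0 & B]) [:: 0, 0 & Y].
Proof.
elim/last_ind: A B => [|A a IH] B; first by exists B; apply: seq_equiv_refl.
have [Y eY] := IH (a :: B); exists Y; apply: seq_equiv_trans eY.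
rewrite cat_rcons.
by have := zero_shift A a 0 B (- a); rewrite subrr sub0r opprK.
Qed.

Lemma zero_entry A B :
  seq_equiv (A ++ 0 :: B) [:: 0] \/ exists Y, seq_equiv (A ++ 0 :: B) [:: 0, 0 & Y].
Proof.
case: (lastP A) => [|{}A a].
  case: B => [|b B]; [left | right]; first exact: seq_equiv_refl.
  by exists B; apply: zero_shiftl.
right; case: B => [|b B]; rewrite cat_rcons.
  have [Y eY] := zero_pair_front A [::]; exists Y.
  exact: seq_equiv_trans (zero_shiftr A a 0) eY.
have [Y eY] := zero_pair_front A (b + a :: B); exists Y.
apply: seq_equiv_trans eY.
by have := zero_shift A a b B (- a); rewrite subrr opprK.
Qed.

(** Blowing up next to a positive entry on its right lowers it by one. *)
Lemma nonneg_entry A x B : 0 <= x ->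
  seq_equiv (A ++ x :: B) [:: 0] \/ exists Y, seq_equiv (A ++ x :: B) [:: 0, 0 & Y].
Proof.
case: x => // n _; elim: n B => [|n IH] B; first exact: zero_entry.
have e1 : seq_equiv (A ++ n.+1%:Z :: B) (A ++ n%:Z :: insblow 0 B).
  have := seq_equiv_insblow A (k := 0) (X := n.+1%:Z :: B) isT.
  by rewrite /= (_ : n.+1%:Z - 1 = n) //; lia.
have [e2|[Y eY]] := IH (insblow 0 B); [left | right; exists Y].
  exact: seq_equiv_trans e1 e2.
exact: seq_equiv_trans e1 eY.
Qed.

Lemma unblow A B : exists2 X, seq_equiv X (A ++ -1 :: B) & size X = (size A + size B)%N.
Proof.
(* B' is the right part before the blowing-up: its first entry, if any, has
   one more. *)
pose B' := if B is b :: B' then b + 1 :: B' else [::].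
have EB : insblow 0 B' = -1 :: B by rewrite /B'; case: (B) => //= b B0; rewrite addrK.
have sB : size B' = size B by rewrite /B'; case: (B).
case: (lastP A) => [|{}A a].
  by exists B'; rewrite //= -EB; apply: seq_equiv_insblow0.
exists (A ++ a + 1 :: B'); last by rewrite size_cat size_rcons /= sB addSn addnS.
rewrite cat_rcons -EB.
by have := seq_equiv_insblow A (k := 0) (X := a + 1 :: B') isT; rewrite /= addrK.
Qed.

(** A blowing-up at the left end of X is not one of 0, 0, X, but it becomes one
    of the edge on its left, up to a change of the second entry 0, which the
    first one allows. *)
Lemma zero_pair_cong X Y : seq_equiv X Y -> seq_equiv [:: 0, 0 & X] [:: 0, 0 & Y].
Proof.
elim=> {X Y} [X Y [k kX ->]|X|X Y _|X Y Z _ XY _ YZ].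
- case: k kX => [|k] kX.
    apply: seq_equiv_trans (seq_equiv_insblow [:: 0] (k := 0) (X := 0 :: X) isT) _.
    exact: zero_shiftl.
  exact: (seq_equiv_insblow [:: 0; 0] kX).
- exact: seq_equiv_refl.
- exact: seq_equiv_sym.
- exact: seq_equiv_trans XY YZ.
Qed.

Definition zero_pairs k Z := iter k (fun Y : seq int => [:: 0, 0 & Y]) Z.

Lemma seq_equiv_wnorm (R : realType) X Y :
  seq_equiv X Y -> wnorm R (chain X) = wnorm R (chain Y).
Proof. by move/seq_equiv_chain/wnorm_equiv. Qed.

(** Induction on the norm, then on the length: splitting off 0, 0 may lengthen
    the rest but lowers its norm, and contracting a -1 keeps the norm and
    shortens the chain. *)
Lemma normal_form (R : realType) X :
  exists k Z, seq_equiv X (zero_pairs k Z) /\ (Z = [:: 0] \/ reduced Z).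
Proof.
have [m] := ubnP (wnorm R (chain X)); elim: m X => // m IHm X.
have [n] := ubnP (size X); elim: n X => // n IHn X ltXn leXm.
have [/hasP[x xX x0]|noneg] := boolP (has (fun x => 0 <= x) X).
  case/splitPr: xX ltXn leXm => A B ltXn leXm.
  have [e0|[Y eY]] := nonneg_entry A B x0; first by exists 0%N, [:: 0]; split; [|left].
  have [|k [Z [eZ hZ]]] := IHm Y.
    by move: leXm; rewrite (seq_equiv_wnorm R eY) wnorm_zero_pair !ltnS.
  exists k.+1, Z; split=> //; apply: seq_equiv_trans eY _.
  exact: zero_pair_cong.
have [m1|nom1] := boolP (-1 \in X); last first.
  exists 0%N, X; split; [exact: seq_equiv_refl | right].
  apply/allP => x xX; move/hasPn/(_ x xX): noneg; rewrite -ltNge => x0.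
  have x1 : x != -1 by apply: contraNneq nom1 => <-.
  by lia.
case/splitPr: m1 ltXn leXm noneg => A B ltXn leXm _.
have [Y eY sY] := unblow A B.
have [||k [Z [eZ hZ]]] := IHn Y.
- by move: ltXn; rewrite sY size_cat /= addnS ltnS.
- by rewrite (seq_equiv_wnorm R eY).
exists k, Z; split=> //; apply: seq_equiv_trans eZ; exact: seq_equiv_sym.
Qed.

Lemma reduced_continuant Z : reduced Z -> 0 <= continuant1 Z < continuant Z.
Proof.
elim: Z => // a Z IH /andP[a2 /IH]; rewrite continuant_cons continuant1_cons.
set c := continuant Z; set c' := continuant1 Z => /andP[c'0 ltc].
apply/andP; split; first by lia.
by nia.
Qed.

(** The uniqueness of Hirzebruch-Jung continued fractions: with c, c' the two
    continuants of Z, the first one of a :: Z is - a * c - c' with 0 <= c' < c,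
    so that a is determined by division with remainder. *)
Lemma reduced_inj Z Z' : reduced Z -> reduced Z' ->
  continuant Z = continuant Z' -> continuant1 Z = continuant1 Z' -> Z = Z'.
Proof.
elim: Z Z' => [|a Z IH] [|a' Z'] // rZ rZ'.
- by case/andP: rZ' => _ /reduced_continuant; rewrite continuant1_cons /= => /andP[? ?] _ E; lia.
- by case/andP: rZ => _ /reduced_continuant; rewrite continuant1_cons /= => /andP[? ?] _ E; lia.
case/andP: rZ rZ' => _ rZ /andP[_ rZ']; rewrite !continuant_cons !continuant1_cons => Ec Ec'.
have := reduced_continuant rZ; have := reduced_continuant rZ'; rewrite Ec' in Ec *.
move=> /andP[b0 b1] /andP[b2 b3].
have Ea : a = a' by nia.
have E1 : continuant1 Z = continuant1 Z' by rewrite Ea in Ec; lia.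
by rewrite Ea (IH Z').
Qed.

Lemma zero_pairs_continuant k Z :
  continuant (zero_pairs k Z) = (-1) ^+ k * continuant Z /\
  continuant1 (zero_pairs k Z) = (-1) ^+ k * continuant1 Z.
Proof.
elim: k => [|k [IH IH1]]; first by rewrite !mul1r.
rewrite [zero_pairs _ _]/= -/(zero_pairs k Z).
by rewrite !(continuant_cons, continuant1_cons) IH IH1 exprS; split; ring.
Qed.

Lemma zero_pairs_wnorm (R : realType) k Z :
  wnorm R (chain (zero_pairs k Z)) = (k + wnorm R (chain Z))%N.
Proof. by elim: k => //= k IH; rewrite wnorm_zero_pair IH. Qed.

Lemma chain_classification (R : realType) X X' :
  wnorm R (chain X) = wnorm R (chain X') -> continuant X = continuant X' ->
  (continuant X %| continuant1 X - continuant1 X')%Z -> seq_equiv X X'.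
Proof.
move=> En Ed E1.
have [k [Z [eZ hZ]]] := normal_form R X.
have [k' [Z' [eZ' hZ']]] := normal_form R X'.
suff [Ek EZ] : k = k' /\ Z = Z'.
  by apply: seq_equiv_trans eZ _; rewrite Ek EZ; apply: seq_equiv_sym.
have [Ec Ec1] := zero_pairs_continuant k Z; have [Ec' Ec1'] := zero_pairs_continuant k' Z'.
move: En (Ed); rewrite (seq_equiv_wnorm R eZ) (seq_equiv_wnorm R eZ').
rewrite !zero_pairs_wnorm (seq_equiv_continuant eZ) (seq_equiv_continuant eZ') Ec Ec'.
have sgn0 n : (-1) ^+ n != 0 :> int by rewrite signr_eq0.
case: hZ hZ' => [-> |rZ] [-> |rZ'].
- by rewrite !wnorm_zero !addn1 => -[].
- move=> _ /eqP; rewrite [continuant [:: 0]]/= mulr0 eq_sym mulf_eq0 (negPf (sgn0 _)).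
  by have := reduced_continuant rZ' => /andP[? ?] /eqP; lia.
- move=> _ /eqP; rewrite [continuant [:: 0]]/= mulr0 mulf_eq0 (negPf (sgn0 _)).
  by have := reduced_continuant rZ => /andP[? ?] /eqP; lia.
rewrite !wnorm_reduced // !addn0 => Ek; subst k'.
move/(mulfI (sgn0 k)) => EZ; split=> //; apply: reduced_inj => //.
have dZ : (continuant Z %| continuant1 Z - continuant1 Z')%Z.
  have d1 := seq_equiv_continuant1 eZ; have d2 := seq_equiv_continuant1 eZ'.
  rewrite -Ed in d2.
  have : (continuant X %| (-1) ^+ k * (continuant1 Z - continuant1 Z'))%Z.
    rewrite mulrBr -Ec1 -Ec1'.
    have := rpredD (rpredB d2 d1) E1; congr (_ %| _)%Z; ring.
  rewrite (seq_equiv_continuant eZ) Ec !dvdzE !abszM !abszX /= !exp1n !mul1n.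
  by [].
have := reduced_continuant rZ; have := reduced_continuant rZ'; rewrite -EZ.
move=> /andP[b0 b1] /andP[b2 b3].
case/dvdzP: dZ => q Eq.
(* Two residues in [0, d[ that are congruent modulo d are equal. *)
have q0 : q = 0 by nia.
by move: Eq; rewrite q0 mul0r => /eqP; rewrite subr_eq0 => /eqP.
Qed.

(** * Labelings of a chain *)

Lemma chain_wtE X i j : chain_wt X i j =
  (i == j)%:R * X`_i + ((i.+1 == j)%:R + (if i is i'.+1 then (i' == j)%:R else 0)).
Proof.
rewrite /chain_wt; case: eqVneq => [<-|nij].
  by rewrite mul1r (_ : i.+1 == i = false); [case: i => [|i]; rewrite ?add0r ?addr0 //;
    rewrite (_ : i == i.+1 = false) ?addr0 | ]; lia.
rewrite mul0r add0r; case: i nij => [|i] nij; first by rewrite addr0 orbF.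
by rewrite eqSS eq_sym; case: eqP => /= [->|]; case: eqP => //=; lia.
Qed.

Lemma sum_chain_wt X i (y : nat -> int) : (i < size X)%N ->
  (forall k, (size X <= k)%N -> y k = 0) ->
  \sum_(j < size X) chain_wt X i j * y j =
  X`_i * y i + y i.+1 + (if i is i'.+1 then y i' else 0).
Proof.
move=> lti y0.
have pick k : \sum_(j < size X) (k == j :> nat)%:R * y j = y k.
  by rewrite sum_pick; case: ltnP => // /y0.
transitivity (X`_i * (\sum_(j < size X) (i == j :> nat)%:R * y j) +
   \sum_(j < size X) (i.+1 == j :> nat)%:R * y j +
   \sum_(j < size X) (if i is i'.+1 then (i' == j :> nat)%:R else 0) * y j).
  rewrite mulr_sumr -!big_split; apply: eq_bigr => j _.
  rewrite chain_wtE /=; ring.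
rewrite !pick; congr (_ + _); case: i {lti} => [|i]; last exact: pick.
by rewrite big1 // => j _; rewrite mul0r.
Qed.

Lemma chain_labeling d X (f : chain X -> int) :
  labeling d f <-> forall i, (i < size X)%N ->
    (d %| X`_i * extend0 (f : 'I_(size X) -> int) i +
          extend0 (f : 'I_(size X) -> int) i.+1 +
          (if i is i'.+1 then extend0 (f : 'I_(size X) -> int) i' else 0))%Z.
Proof.
have rowE (i : 'I_(size X)) : \sum_(v : chain X) wmat (i : chain X) v * f v =
    X`_i * extend0 (f : 'I_(size X) -> int) i +
          extend0 (f : 'I_(size X) -> int) i.+1 +
          (if nat_of_ord i is i'.+1 then extend0 (f : 'I_(size X) -> int) i' else 0).
  rewrite -sum_chain_wt // => [|k]; last exact: extend0_out.
  by apply: eq_bigr => j _; rewrite extend0_ord.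
split=> [lf i lti|rows i]; last by rewrite rowE; apply: rows.
by have := lf (Ordinal lti); rewrite rowE.
Qed.

(** Along a chain, the rows determine the labels one after the other from the
    last one, by the recursion of the continuants. Here y lists the labels of a
    chain that consists of one vertex followed by X. *)
Lemma chain_labeling_first d X (y : nat -> int) : y (size X).+1 = 0 ->
  (forall i, (i < size X)%N -> (d %| X`_i * y i.+1 + y i.+2 + y i)%Z) ->
  (d %| y 0%N - y (size X) * continuant X)%Z /\
  (d %| y 1%N - y (size X) * continuant1 X)%Z.
Proof.
elim: X y => [|b X IH] y yS rows.
  by rewrite /= mulr1 subrr dvdz0 yS mulr0 subrr.
have [d0 d1] := IH (y \o S) yS (fun i lti => rows i.+1 lti).
split; last by [].
have := rpredB (rpredB (rows 0%N isT) (dvdz_mull b d0)) d1.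
rewrite continuant_cons /=; congr (_ %| _)%Z; ring.
Qed.

Lemma chain_labeling_ends d a X (g : chain (a :: X) -> int) : labeling d g ->
  (d %| extend0 (g : 'I_(size X).+1 -> int) 0 -
        extend0 (g : 'I_(size X).+1 -> int) (size X) * continuant X)%Z.
Proof.
move=> /chain_labeling; set y := extend0 _ => rows.
have y0 : y (size X).+1 = 0 by rewrite /y extend0_out.
have [|H _] := chain_labeling_first y0 (d := d) (X := X).
  by move=> i lti; apply: (rows i.+1).
exact: H.
Qed.

Lemma chain_labeling_ends_rev d a X (g : chain (a :: X) -> int) : labeling d g ->
  (d %| extend0 (g : 'I_(size X).+1 -> int) (size X) -
        extend0 (g : 'I_(size X).+1 -> int) 0 * continuant1 (rev (a :: X)))%Z.
Proof.
move=> /chain_labeling; set y := extend0 _ => rows.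
have nthr k : (k <= size X)%N -> (rev (a :: X))`_k = (a :: X)`_(size X - k).
  by move=> lek; rewrite nth_rev //= subSS.
have szr : size (rev (a :: X)) = (size X).+1 by rewrite size_rev.
case: (rev _) nthr szr => [|b Z] // nthr [szZ].
pose z k := if (k <= size X)%N then y (size X - k)%N else 0.
have z0 : z (size Z).+1 = 0.
  by rewrite /z szZ ltnn.
have [i|+ _] := chain_labeling_first z0 (d := d).
- rewrite szZ => lti.
  have := rows (size X - i.+1)%N; rewrite -nthr //= /z lti (ltnW lti).
  move=> /(_ (leq_subr _ _)); rewrite -subSn // subSS.
  congr (_ %| _)%Z; rewrite -!addrA; congr (_ + _); rewrite addrC; congr (_ + _).
  case: (ltnP i.+1 (size X)) => [lti2|gei2].
    by rewrite (_ : size X - i.+1 = (size X - i.+2).+1)%N //; lia.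
  by rewrite (_ : size X - i.+1 = 0)%N //; lia.
- by rewrite /z szZ leqnn subnn subn0.
Qed.

(** The label of a vertex is the continuant of the part of the chain on its
    right; the row of the first vertex is then minus the determinant. *)
Lemma chain_labeling_exists a X :
  exists2 f : chain (a :: X) -> int, labeling (continuant (a :: X)) f &
    extend0 (f : 'I_(size X).+1 -> int) 0 = continuant X /\
    extend0 (f : 'I_(size X).+1 -> int) (size X) = 1.
Proof.
pose f (i : chain (a :: X)) : int := continuant (drop (i : 'I_(size X).+1) X).
have fE k : (k <= size X)%N -> extend0 (f : 'I_(size X).+1 -> int) k = continuant (drop k X).
  by move=> lek; rewrite -[k]/(val (Ordinal (lek : k < (size X).+1)%N)) extend0_ord.
exists f; last by rewrite !fE // drop0 drop_size.
have fE1 k : (k <= size X)%N ->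
    extend0 (f : 'I_(size X).+1 -> int) k.+1 = continuant1 (drop k X).
  rewrite leq_eqVlt => /predU1P[->|ltk]; first by rewrite extend0_out // drop_size.
  by rewrite fE // (drop_nth 0 ltk).
apply/chain_labeling => -[|i] lti; rewrite [nth _ _ _]/=.
  rewrite fE // fE1 // drop0.
  by rewrite addr0 -rpredN (_ : - _ = continuant (a :: X)) ?dvdzz //; rewrite continuant_cons; ring.
rewrite fE // fE1 // fE 1?ltnW // (drop_nth 0 (lti : i < size X)%N).
rewrite [X in (_ %| X)%Z](_ : _ = 0) ?dvdz0 // continuant_cons; ring.
Qed.

Lemma chain_wdeg (X : seq int) (i : chain X) :
  wdeg i = ((i : 'I_(size X)).+1 < size X)%N%:R + (0 < (i : 'I_(size X)))%N%:R.
Proof.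
have pick k : \sum_(j < size X) (k == j :> nat)%:R = (k < size X)%N%:R :> int.
  under eq_bigr do rewrite -[_%:R]mulr1.
  by rewrite (sum_pick _ (fun=> 1)); case: ltnP.
rewrite /wdeg -pick.
transitivity (\sum_(j < size X) ((i : 'I_(size X)).+1 == j :> nat)%:R +
   \sum_(j < size X) (j.+1 == (i : 'I_(size X)) :> nat)%:R : int).
  rewrite -big_split; apply: eq_bigr => j _; rewrite /= /chain_adj.
  by do 2!case: eqP => //=; lia.
congr (_ + _); case: (nat_of_ord i) (ltn_ord i) => [|k] ltk.
  by rewrite big1.
by under eq_bigr do rewrite eqSS eq_sym; rewrite pick ltnW.
Qed.

Lemma label_divisor_chain d b X (f : chain (b :: X) -> int) a :
  label_divisor d f a = - (d %| extend0 (f : 'I_(size X).+1 -> int) 0 - a)%Z%:R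
               - (d %| extend0 (f : 'I_(size X).+1 -> int) (size X) - a)%Z%:R.
Proof.
set y := extend0 _.
pose p (i : nat) : int := (d %| y i - a)%Z%:R.
have pick k : (k < (size X).+1)%N -> \sum_(j < (size X).+1) (k == j :> nat)%:R * p j = p k.
  by move=> ltk; rewrite sum_pick ltk.
rewrite -[RHS]/(- p 0%N - p (size X)) -(pick 0%N) // -(pick (size X)) //.
rewrite -opprD -big_split -sumrN.
rewrite /label_divisor big_mkcond; apply: eq_bigr => i _.
rewrite chain_wdeg /p /y extend0_ord /=.
have := ltn_ord (i : 'I_(size X).+1); rewrite /=; set k := nat_of_ord _ => ltk.
case: (f i - a \in dvdz d); last by rewrite !mulr0.
by rewrite !mulr1 ltnS; case: (ltngtP k (size X)) ltk; case: (posnP k) => //=; lia.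
Qed.

(** Transfer to X' the labeling of X whose end labels are det1 X and 1.  By the
    divisors, one end label of X' is 1 and the other one is det1 X; which end has
    label 1 decides between X' and rev X'. *)
Lemma chain_equiv_continuant1 X X' : wg_equiv (chain X) (chain X') ->
  (continuant X %| continuant1 X - continuant1 X')%Z \/
  (continuant X %| continuant1 X - continuant1 (rev X'))%Z.
Proof.
move=> eXX'; have Ed : continuant X = continuant X'.
  by have := wdet_equiv eXX'; rewrite -/(Defs.det0 X) -/(Defs.det0 X') !det0_continuant.
(* Modulo a unit everything is 0, and the divisors carry no information. *)
have [d1|d1] := boolP (continuant X %| 1)%Z.
  by left; rewrite -[_ - _]mulr1 dvdz_mull.
case: X eXX' Ed d1 => [|a X] eXX' Ed d1; first by rewrite dvdzz in d1.
set d := continuant (a :: X) in Ed d1 *.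
have [f lf [f0 f1]] := chain_labeling_exists a X.
have [g lg Eg] := label_transfer_equiv eXX' lf.
case: X' eXX' Ed g lg Eg => [|a' X'] eXX' Ed g lg Eg.
  by move: d1; rewrite -/d Ed dvdzz.
pose y := extend0 (g : 'I_(size X').+1 -> int).
have {}Eg b : ~~ (d %| b)%Z ->
    ((d %| continuant X - b)%Z%:R + (d %| 1 - b)%Z%:R =
     (d %| y 0%N - b)%Z%:R + (d %| y (size X') - b)%Z%:R :> int).
  by move=> /Eg; rewrite !label_divisor_chain f0 f1 -/y => /(congr1 -%R); rewrite !opprD !opprK.
(* The multisets {continuant X, 1} and {u, v} agree off 0; cancelling u = 1
   leaves continuant X = v, also when one of the two is 0. *)
have other u v : (d %| u - 1)%Z -> (forall b, ~~ (d %| b)%Z ->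
    ((d %| continuant X - b)%Z%:R + (d %| 1 - b)%Z%:R =
     (d %| v - b)%Z%:R + (d %| u - b)%Z%:R :> int)) -> (d %| continuant X - v)%Z.
  move=> u1 E; have {}E b : ~~ (d %| b)%Z -> (d %| continuant X - b)%Z = (d %| v - b)%Z.
    move=> /E; have -> : (d %| 1 - b)%Z = (d %| u - b)%Z.
      by rewrite -[RHS](rpredBr _ u1); congr (_ %| _)%Z; ring.
    by move/addIr; do 2!case: (_ %| _)%Z.
  have [v0|/E] := boolP (d %| v)%Z; last by rewrite subrr dvdz0 => ->.
  have [x0|/E] := boolP (d %| continuant X)%Z; first exact: rpredB.
  by rewrite subrr dvdz0 -opprB rpredN => <-.
have y1 : (d %| y (size X') - 1)%Z \/ (d %| y 0%N - 1)%Z.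
  apply/orP; have := Eg 1 d1; rewrite subrr dvdz0.
  by do 3!case: (_ %| _)%Z.
have ends := chain_labeling_ends lg; have ends' := chain_labeling_ends_rev lg.
case: y1 => y1; [left | right].
  have := rpredD (rpredD (other _ _ y1 Eg) ends) (dvdz_mull (continuant X') y1).
  rewrite !continuant1_cons -/y; congr (_ %| _)%Z; ring.
have {}Eg b : ~~ (d %| b)%Z ->
    ((d %| continuant X - b)%Z%:R + (d %| 1 - b)%Z%:R =
     (d %| y (size X') - b)%Z%:R + (d %| y 0%N - b)%Z%:R :> int).
  by move=> /Eg ->; rewrite addrC.
have := rpredD (rpredD (other _ _ y1 Eg) ends') (dvdz_mull (continuant1 (rev (a' :: X'))) y1).
rewrite !continuant1_cons -/y; congr (_ %| _)%Z; ring.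
Qed.

(** * The classification *)

Lemma SubP (G : wgraph) z : Defs.Sub G z ->
  exists2 X, wg_iso (chain X) G & z = continuant1 X.
Proof.
case=> X [iso [->|->]]; rewrite det1_continuant1; first by exists X.
by exists (rev X) => //; apply: wg_iso_trans (chain_rev_iso X) iso.
Qed.

Theorem corollary5p4 (R : realType) (L L' : wgraph)
    (hL : linear_chain L) (hL' : linear_chain L') :
  wg_equiv L L' <->
  [/\ wnorm R L = wnorm R L',
      wdet L = wdet L' &
      (Subbar L `&` Subbar L' !=set0)%classic].
Proof.
have wdetE' X G : wg_iso (chain X) G -> wdet G = continuant X.
  by move=> /wdet_iso <-; apply: det0_continuant.
split=> [eLL'|[En Ed [z [[x /SubP[X isoX ->] Ex] [x' /SubP[X' isoX' ->] Ex']]]]].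
  split; [exact: wnorm_equiv | exact: wdet_equiv |].
  have [X isoX] := linear_chain_iso hL; have [X' isoX'] := linear_chain_iso hL'.
  have /chain_equiv_continuant1 cX : wg_equiv (chain X) (chain X').
    apply: rst_trans (wg_iso_equiv isoX) _; apply: rst_trans eLL' _.
    exact: wg_iso_equiv (wg_iso_sym isoX').
  exists (continuant1 X %% continuant X)%Z; split.
    exists (continuant1 X); last by rewrite (wdetE' X).
    by exists X; rewrite det1_continuant1; split=> //; left.
  rewrite /Subbar -(wdet_equiv eLL') (wdetE' X) //.
  case: cX => /eqP cX; [exists (continuant1 X') | exists (continuant1 (rev X'))].
  - by exists X'; rewrite det1_continuant1; split=> //; left.
  - by apply/esym/eqP; rewrite eqz_mod_dvd; apply/eqP.
  - by exists X'; rewrite (det1_continuant1 (rev _)); split=> //; right.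
  - by apply/esym/eqP; rewrite eqz_mod_dvd; apply/eqP.
apply: rst_trans (wg_iso_equiv (wg_iso_sym isoX)) _.
apply: rst_trans (wg_iso_equiv isoX').
apply/seq_equiv_chain/(@chain_classification R).
- by rewrite (wnorm_equiv R (wg_iso_equiv isoX)) (wnorm_equiv R (wg_iso_equiv isoX')).
- by rewrite -(wdetE' X L) // -(wdetE' X' L').
- rewrite -eqz_mod_dvd; apply/eqP.
  by rewrite -(wdetE' X L) // Ex -Ex' Ed.
Qed.
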